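(* Let $C\subset\mathbb{T}^{2}$ be a convex body with $\mathcal{C}^{2}$ boundary. Then there exists $c>0$ such that for every integer $N\geqslant 1$ and every set $\mathcal{P}_{N}$ of $N$ points in $\mathbb{T}^{2}$ we have $$\int_{0}^{1}\int_{\mathbb{T}^{2}}\left\vert \mathrm{card}\left(\mathcal{P}_{N}\cap\left(\lambda C+t\right)\right)-\lambda^{2}N\left\vert C\right\vert \right\vert ^{2}\,dt\,d\lambda\geqslant cN^{1/2}.$$
   Context: $\mathbb{T}^{2}=\mathbb{R}^{2}/\mathbb{Z}^{2}$. A planar convex body is a bounded convex subset of $\mathbb{R}^2$ with non-empty interior, and $|C|$ is its area. A convex body in $\mathbb{T}^2$ is a planar convex body regarded in $\mathbb{T}^2$ through the projection $\mathbb{R}^2\to\mathbb{T}^2$. For $\mathcal{P}_N=\{u_1,\dots,u_N\}\subset\mathbb{T}^2$, $\lambda>0$ and $t\in\mathbb{T}^2$, $\mathrm{card}(\mathcal{P}_N\cap(\lambda C+t))$ denotes $\sum_{j=1}^N\sum_{k\in\mathbb{Z}^2}\chi_{\lambda C}(u_j-t+k)$, where $\chi_{\lambda C}$ is the characteristic function of $\lambda C\subset\mathbb{R}^2$; this is the ordinary number of points of $\mathcal{P}_N$ in the translated set $\lambda C+t$ whenever $\lambda C$ projects injectively to $\mathbb{T}^2$. No curvature assumption is made on the boundary: $\mathcal{C}^2$ boundary means that the arc length parameterization of $\partial C$ is a $\mathcal{C}^2$ closed curve. *)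

(* Defs.v *)
From HB Require Import structures.
From mathcomp Require Import all_boot all_order all_algebra.
From mathcomp Require Import finmap generic_quotient.
From mathcomp Require Import all_classical all_reals all_analysis.

Set Implicit Arguments.
Unset Strict Implicit.
Unset Printing Implicit Defensive.

Import Order.TTheory GRing.Theory Num.Theory.
Import numFieldNormedType.Exports.

Local Open Scope classical_set_scope.
Local Open Scope ring_scope.
Local Open Scope quotient_scope.

Section Torus.
Context {R : realType}.

Definition congr_Z2 (x y : R * R) : bool :=
  (x.1 - y.1 \is a Num.int) && (x.2 - y.2 \is a Num.int).

Lemma congr_Z2_refl : reflexive congr_Z2.
Proof. by move=> x; rewrite /congr_Z2 !subrr !rpred0. Qed.

Lemma congr_Z2_sym : symmetric congr_Z2.
Proof.
by move=> x y; rewrite /congr_Z2 -(opprB y.1) -(opprB y.2) !rpredN.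
Qed.

Lemma congr_Z2_trans : transitive congr_Z2.
Proof.
move=> y x z /andP[xy1 xy2] /andP[yz1 yz2]; apply/andP; split.
  by rewrite -(subrKA y.1) rpredD.
by rewrite -(subrKA y.2) rpredD.
Qed.

Canonical congr_Z2_equiv :=
  EquivRel congr_Z2 congr_Z2_refl congr_Z2_sym congr_Z2_trans.

Definition intpair (k : int * int) : R * R := (k.1%:~R, k.2%:~R).

End Torus.

Definition torus (R : realType) : Type := {eq_quot (@congr_Z2 R)}.

Section Plane.
Context {R : realType}.

Definition area (C : set (R * R)) : R :=
  fine ((lebesgue_measure \x lebesgue_measure)%E C).

(* The body need not be closed, nor even Borel. Its horizontal and vertical
   sections are intervals, so [area] is nevertheless its usual area; and since
   [\int] of a nonnegative function is the supremum over the measurable simple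
   functions below it, the integrals of functions that are only Lebesgue
   measurable keep their usual values. *)
Definition convex_body (C : set (R * R)) : Prop :=
  [/\ bounded_set C, convex_set C & C° !=set0].

Definition boundary (C : set (R * R)) : set (R * R) := closure C `\` C°.

Definition C2 (f : R -> R) : Prop :=
  [/\ forall s, derivable f s 1, forall s, derivable (derive1 f) s 1 &
      continuous (derive1n 2 f)].

(* [(x, y)] is the [L]-periodic extension of the arc length parameterization;
   being C^2 on all of [R] it is C^2 as a closed curve. *)
Definition C2_boundary (C : set (R * R)) : Prop :=
  exists (L : R) (x y : R -> R),
    [/\ 0 < L,
        forall s, x (s + L) = x s /\ y (s + L) = y s,
        C2 x /\ C2 y,
        forall s, derive1 x s ^+ 2 + derive1 y s ^+ 2 = 1 &
        set_bij `[0, L[ (boundary C) (fun s => (x s, y s))].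

Definition dilate (lambda : R) (C : set (R * R)) : set (R * R) :=
  [set lambda *: x | x in C].

(* The sum over Z^2 has finite support for bounded [C], and as it runs over all
   of Z^2 it does not depend on the representatives of [u] and [t]. *)
Definition card_translate (P : {fset torus R}) (C : set (R * R))
    (t : torus R) : R :=
  \sum_(u <- P) \sum_(k \in [set: int * int])
    (\1_C (repr u - repr t + intpair k) : R).

(* Integral for the Haar probability measure of the torus, i.e. Lebesgue measure
   on a fundamental domain. *)
Definition torus_integral (f : torus R -> \bar R) : \bar R :=
  (\int[lebesgue_measure \x lebesgue_measure]_(x in `[0%R, 1%R[ `*` `[0%R, 1%R[)
     f (\pi_(torus R) x))%E.

End Plane.

(* Main.v *)
From HB Require Import structures.
Require Import Defs.
From mathcomp Require Import all_boot all_order all_algebra.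
From mathcomp Require Import finmap generic_quotient.
From mathcomp Require Import all_classical all_reals all_analysis.
From mathcomp Require Import measurable_realfun zify ring lra.

Set Implicit Arguments.
Unset Strict Implicit.
Unset Printing Implicit Defensive.

Import Order.TTheory GRing.Theory Num.Theory.
Import numFieldNormedType.Exports.

Local Open Scope classical_set_scope.
Local Open Scope ring_scope.

(** Write u_1, ..., u_N for the points, S(k) for the exponential sum
    sum_j exp(2 i pi k.u_j), D(l, t) for the discrepancy of l C + t, and 1_E for
    the indicator of E.  For k <> 0 the k-th Fourier coefficient of D(l, .) is
    S(k) times the Fourier transform of 1_(l C) at k; the area term only affects
    k = 0.  So by Parseval the theorem asks for two lower bounds: one for the
    transforms of the dilates of C, on average over l, and one for the sums of
    |S(k)|^2.

    Parseval is used through a test function.  If F is a real trigonometric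
    polynomial with the frequencies of interest, then for every tau
      D^2 >= 2 tau D F - tau^2 F^2,
    and the right-hand side can be integrated exactly: D F by unfolding the torus
    ([unfold_torus_integral]), F^2 by orthogonality ([integral_cos_torus]).  This
    is [torus_inequality].  The right-hand side is linear in D, so it also gives
    measurable minorants, which suffice although C need not be a Borel set:
    integrals of nonnegative functions are lower integrals
    ([integrable_le_lower_integral]), and C differs from its interior by points
    of the boundary, which is null, being a curve of finite length ([curve_null]).

    For a fixed frequency k, let xi = 2 pi k, let r be the size of xi and let a
    be the minimum of xi.y on the closure of C.  The phase of the test function
    at dilation l is chosen so that, after weighting by (1 - l)^3, the mean over l
    of the transform of l C becomes the integral over C of
      K(xi.y - a + 20),  K(v) = - int_0^1 l^2 (1 - l)^3 sin(l v) dl.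
    Since K(v) >= v^-3 for v >= 20 ([radial_kernel_ge]), this integrand is
    positive on all of C, and is bounded below on the strip where
    xi.y <= a + 1.  No decay of a Fourier transform has to be estimated: only the
    area of the strip matters ([radial_transform_ge]).

    The boundary is C2, so near the point where xi.y is minimal it stays within a
    constant times s^2 of its tangent line, s being the arc length.  Hence a piece
    of boundary of length of order r^(-1/2) lies in the strip, and moving it
    slightly towards a ball inside C gives a tube of width of order 1/r.  The
    strip thus has area at least c r^(-3/2), uniformly in the direction of xi,
    whether or not the boundary is curved there ([strip_area]).

    Finally, the sum of |S(n - n')|^2 over all pairs of points n, n' of an X by X
    integer square is a sum over pairs (i, j) of squared moduli, in which the
    pairs i = j alone contribute N X^4 ([sum_power_all]).  The terms n = n'
    contribute N^2 X^2, so for X of order 2 sqrt N the differences n - n' <> 0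
    account for at least half of N X^4.  As their transforms are at least
    c X^(-3/2), the integral of D^2 is at least a constant times
    X^-5 * N X^4 = N / X, that is, a constant times sqrt N.  *)

(** * Lower bounds for integrals of nonnegative functions *)

Section lower_integral.
Context d (T : measurableType d) (R : realType).
Variable mu : {measure set T -> \bar R}.
Local Open Scope ereal_scope.

(** The integral of a nonnegative function is the supremum of the integrals of the
    simple functions below it, so it is monotone even between functions that are
    not measurable. *)
Lemma le_lower_integral (D : set T) (f g : T -> \bar R) :
  (forall x, D x -> 0 <= f x) -> (forall x, D x -> f x <= g x) ->
  \int[mu]_(x in D) f x <= \int[mu]_(x in D) g x.
Proof.
move=> f0 fg; rewrite !(integral_mkcond D).
have h10 x : 0 <= (f \_ D) x by apply: erestrict_ge0.
have h12 x : (f \_ D) x <= (g \_ D) x by apply: lee_restrict.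
rewrite !ge0_integralTE//; last by move=> x; exact: le_trans (h12 x).
apply: ereal_sup_le => _ [h /= hf <-]; exists h => // x.
exact: le_trans (hf x) (h12 x).
Qed.

(** The form in which lower bounds are used: the minorant [g] may change sign, and
    may fail to be a minorant on a null set, but only [g] has to be integrable.
    The positive part of [g], cut off outside [N], lies below [f]. *)
Lemma integrable_le_lower_integral (D N : set T) (f : T -> \bar R) (g : T -> R) :
  measurable D -> measurable N -> mu N = 0 -> mu.-integrable D (EFin \o g) ->
  (forall x, D x -> 0 <= f x) -> (forall x, D x -> ~ N x -> (g x)%:E <= f x) ->
  (Rintegral mu D g)%:E <= \int[mu]_(x in D) f x.
Proof.
move=> mD mN N0 ig f0 gf.
rewrite /Rintegral fineK; last exact: integrable_fin_num.
have mh : measurable_fun D ((EFin \o g)^\+ : T -> \bar R).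
  by apply: measurable_funepos; exact: measurable_int ig.
have h0 x : 0 <= (EFin \o g)^\+ x by rewrite funeposE le_max lexx orbT.
apply: (@le_trans _ _ (\int[mu]_(x in D) (EFin \o g)^\+ x)).
  by rewrite integralE geeDl// oppe_le0 integral_ge0.
rewrite (ge0_negligible_integral mN mD mh)//.
rewrite integral_mkcond [leRHS]integral_mkcond.
apply: le_lower_integral => x _.
  by apply: erestrict_ge0.
rewrite /patch; case: ifPn => [|_].
  by rewrite inE => -[Dx Nx]; rewrite mem_set// funeposE ge_max gf//= f0.
by case: ifPn => //; rewrite inE => Dx; exact: f0.
Qed.

End lower_integral.

(** * Bounded measurable functions *)

Section bounded_functions.
Context d (T : measurableType d) (R : realType).

Definition bounded_measurable (f : T -> R) :=
  measurable_fun setT f /\ exists M, forall x, `|f x| <= M.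

Lemma bmeas_cst k : bounded_measurable (cst k).
Proof. by split; [exact: measurable_cst|exists `|k|]. Qed.

Lemma bmeasD f g : bounded_measurable f -> bounded_measurable g -> bounded_measurable (fun x => f x + g x).
Proof.
move=> [mf [M fM]] [mg [M' gM']]; split; first exact: measurable_funD.
by exists (M + M') => x; rewrite (le_trans (ler_normD _ _))// lerD.
Qed.

Lemma bmeasM f g : bounded_measurable f -> bounded_measurable g -> bounded_measurable (fun x => f x * g x).
Proof.
move=> [mf [M fM]] [mg [M' gM']]; split; first exact: measurable_funM.
by exists (M * M') => x; rewrite normrM ler_pM.
Qed.

Lemma bmeasN f : bounded_measurable f -> bounded_measurable (fun x => - f x).
Proof.
move=> [mf [M fM]]; split; first exact: measurableT_comp.
by exists M => x; rewrite normrN.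
Qed.

Lemma bmeasB f g : bounded_measurable f -> bounded_measurable g -> bounded_measurable (fun x => f x - g x).
Proof. by move=> mf /bmeasN; exact: bmeasD. Qed.

Lemma bmeas_sum (I : Type) (s : seq I) (P : pred I) (f : I -> T -> R) :
  (forall i, bounded_measurable (f i)) -> bounded_measurable (fun x => \sum_(i <- s | P i) f i x).
Proof.
move=> mf; elim: s => [|i s IH].
  by under eq_fun do rewrite big_nil; exact: bmeas_cst.
under eq_fun do rewrite big_cons.
by case: (P i) => //; apply: bmeasD.
Qed.

Lemma bmeas_indic (A : set T) : measurable A -> bounded_measurable (\1_A : T -> R).
Proof.
move=> mA; split; first exact: measurable_indic.
by exists 1 => x; rewrite indicE; case: (_ \in _); rewrite ?normr1 ?normr0.
Qed.

Lemma bmeas_cos f : measurable_fun setT f -> bounded_measurable (fun x => cos (f x)).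
Proof.
move=> mf; split.
  apply: (measurableT_comp _ mf).
  apply: continuous_measurable_fun.
  exact: continuous_cos.
by exists 1 => x; rewrite ler_norml cos_geN1 cos_le1.
Qed.

Lemma bmeas_sin f : measurable_fun setT f -> bounded_measurable (fun x => sin (f x)).
Proof.
move=> mf; split.
  apply: (measurableT_comp _ mf).
  apply: continuous_measurable_fun.
  exact: continuous_sin.
by exists 1 => x; rewrite ler_norml sin_geN1 sin_le1.
Qed.

Variable mu : {measure set T -> \bar R}.

Lemma bmeas_integrable (D : set T) f : measurable D -> (mu D < +oo)%E ->
  bounded_measurable f -> mu.-integrable D (EFin \o f).
Proof.
move=> mD Doo [mf [M fM]]; apply: measurable_bounded_integrable => //.
  exact: measurable_funTS.
exists M; split; first exact: num_real.
by move=> y My x Dx /=; rewrite (le_trans (fM x))// ltW.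
Qed.

Lemma Rintegral_sum (D : set T) (I : Type) (s : seq I) (P : pred I) (f : I -> T -> R) :
  measurable D -> (forall i, mu.-integrable D (EFin \o f i)) ->
  Rintegral mu D (fun x => \sum_(i <- s | P i) f i x)
  = \sum_(i <- s | P i) Rintegral mu D (f i).
Proof.
move=> mD fi; rewrite /Rintegral.
under eq_integral do rewrite -sumEFin.
rewrite integral_sum// sum_fine// => i _.
by apply: integrable_fin_num => //; exact: fi.
Qed.

End bounded_functions.

(** * Lebesgue measure of the plane under affine maps *)

Section plane.
Context (R : realType).
Notation mu := (@lebesgue_measure R).
Notation mu2 := (mu \x mu)%E.
Notation P2 := (measurableTypeR R * measurableTypeR R)%type.

(** Boxes with rational centre and radius form a countable base of the plane. *)
Lemma open_measurable_plane (A : set (R * R)) : open A -> measurable (A : set P2).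
Proof.
move=> oA.
pose B (q : (rat * rat) * rat) : set (R * R) :=
  ball (ratr q.1.1 : R) (ratr q.2) `*` ball (ratr q.1.2 : R) (ratr q.2).
have -> : A = \bigcup_(q in [set q | B q `<=` A]) B q.
  apply/seteqP; split=> [[x y] Axy|[x y] [q /= BA]]; last exact: BA.
  have /nbhs_ballP[e /= e0 eA] : nbhs (x, y) A by move: oA; rewrite openE; exact.
  have e4 : 0 < e / 2 by rewrite divr_gt0.
  have e40 : e / 4 < e / 2 by lra.
  have [r] := rat_in_itvoo e40; rewrite in_itv/= => /andP[r1 r2].
  have r0 : 0 < (ratr r : R) by apply: lt_trans r1; rewrite divr_gt0.
  have xx : x - e / 4 < x + e / 4 by lra.
  have yy : y - e / 4 < y + e / 4 by lra.
  have [p] := rat_in_itvoo xx; rewrite in_itv/= => /andP[p1 p2].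
  have [q] := rat_in_itvoo yy; rewrite in_itv/= => /andP[q1 q2].
  have px : `|(ratr p : R) - x| < ratr r by rewrite ltr_distl; apply/andP; split; lra.
  have qy : `|(ratr q : R) - y| < ratr r by rewrite ltr_distl; apply/andP; split; lra.
  exists ((p, q), r) => //=; rewrite /B /=.
  move=> [u v] [/=]; rewrite /ball/= => pu qv; apply: eA; split; rewrite /ball/=.
    by rewrite (le_lt_trans (ler_distD (ratr p) _ _))// distrC; lra.
  by rewrite (le_lt_trans (ler_distD (ratr q) _ _))// distrC; lra.
rewrite bigcup_mkcond; apply: (@countable_bigcupT_measurable _ _ _ _ _).
  exact/countableP.
move=> q; case: ifPn => // _; apply: measurableX; apply: measurable_ball.
Qed.

Lemma affine_measurable (a c : R) : measurable_fun setT (fun x : R => a * x + c).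
Proof.
apply: measurable_funD => //; exact: measurable_funM.
Qed.

(** Up to the factor [`|a|], the pushforward agrees with Lebesgue measure on
    half-open intervals, and these determine a measure. *)
Lemma lebesgue_measure_affine (a c : R) (A : set R) : a != 0 -> measurable A ->
  mu ((fun x => a * x + c) @^-1` A) = ((`|a|^-1)%:E * mu A)%E.
Proof.
move=> a0 mA; have na0 : 0 < `|a| by rewrite normr_gt0.
pose phi : R -> measurableTypeR R := fun x => a * x + c.
have mphi : measurable_fun setT phi by exact: affine_measurable.
suff /(_ mphi A mA) -> : forall B, measurable B ->
    mu B = mscale (NngNum (ltW na0)) (pushforward mu phi) B.
  by rewrite /mscale/= muleA -EFinM mulVf ?gt_eqF// mul1e.
move=> mphi0 B mB; apply: lebesgue_measure_unique => //= _ [[u v]] _ <-.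
rewrite /mscale/= /pushforward.
have [a1|a1] : 0 < a \/ a < 0 by move: a0; rewrite neq_lt => /orP[|]; [right|left].
- have -> : phi @^-1` `]u, v]%classic = `](u - c) / a, (v - c) / a]%classic.
    apply/seteqP; split=> x /=; rewrite !in_itv/= /phi.
      by move=> /andP[? ?]; apply/andP; split; rewrite ?ltr_pdivrMr// ?ler_pdivlMr//; lra.
    move=> /andP[]; rewrite ?ltr_pdivrMr// ?ler_pdivlMr// => ? ?.
    by apply/andP; split; lra.
  rewrite !lebesgue_measure_itv/= !lte_fin gtr0_norm//.
  rewrite ltr_pM2r ?invr_gt0// ltrD2r; case: ifPn => _; last by rewrite mule0.
  by rewrite -!EFinB -EFinM; congr EFin; field; rewrite gt_eqF.
- have -> : phi @^-1` `]u, v]%classic = `[(v - c) / a, (u - c) / a[%classic.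
    apply/seteqP; split=> x /=; rewrite !in_itv/= /phi.
      by move=> /andP[? ?]; apply/andP; split; rewrite ?ltr_ndivlMr// ?ler_ndivrMr//; lra.
    move=> /andP[]; rewrite ?ltr_ndivlMr// ?ler_ndivrMr// => ? ?.
    by apply/andP; split; lra.
  rewrite !lebesgue_measure_itv/= !lte_fin ltr0_norm//.
  rewrite ltr_nM2r ?invr_lt0// ltrD2r; case: ifPn => _; last by rewrite mule0.
  by rewrite -!EFinB -EFinM; congr EFin; field; rewrite lt_eqF.
Qed.

Definition affine2 (a : R) (c : R * R) (x : R * R) : R * R :=
  (a * x.1 + c.1, a * x.2 + c.2).

Lemma affine2_measurable (a : R) c : measurable_fun setT (affine2 a c : P2 -> P2).
Proof.
apply/measurable_fun_pairP; split.
  exact: (measurableT_comp (affine_measurable a c.1) measurable_fst).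
exact: (measurableT_comp (affine_measurable a c.2) measurable_snd).
Qed.

Lemma plane_measure_affine (a : R) c (A : set P2) : a != 0 -> measurable A ->
  mu2 (affine2 a c @^-1` A) = ((a ^- 2)%:E * mu2 A)%E.
Proof.
move=> a0 mA; have na0 : 0 < a ^+ 2 by rewrite exprn_even_gt0.
pose phi : P2 -> P2 := affine2 a c.
have mphi : measurable_fun setT phi by exact: affine2_measurable.
suff /(_ mphi A mA) -> : forall B, measurable B ->
    mu2 B = mscale (NngNum (ltW na0)) (pushforward mu2 phi) B.
  by rewrite /mscale/= muleA -EFinM mulVf ?gt_eqF// mul1e.
move=> mphi0 B mB; apply: product_measure_unique => //= X Y mX mY.
rewrite /mscale/= /pushforward.
have -> : phi @^-1` (X `*` Y) = ((fun x => a * x + c.1) @^-1` X) `*` ((fun x => a * x + c.2) @^-1` Y).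
  by [].
rewrite product_measure1E; last 2 first.
- by rewrite -[X in measurable X]setTI; apply: affine_measurable.
- by rewrite -[X in measurable X]setTI; apply: affine_measurable.
transitivity ((a ^+ 2)%:E * ((`|a|^-1)%:E * mu X * ((`|a|^-1)%:E * mu Y)))%E.
  congr (_ * (_ * _))%E; exact: lebesgue_measure_affine.
rewrite (muleACA (`|a|^-1)%:E) (muleA (a ^+ 2)%:E) -[RHS]mul1e; congr (_ * _)%E.
rewrite -!EFinM; congr EFin.
by rewrite -[a ^+ 2]real_normK ?num_real//; field; rewrite normr_eq0.
Qed.

End plane.

(** * Unfolding integrals over the torus *)

Section unfold.
Context (R : realType).
Notation mu := (@lebesgue_measure R).
Notation mu2 := (mu \x mu)%E.
Notation P2 := (measurableTypeR R * measurableTypeR R)%type.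

Lemma ge0_integral_affine2 (a : R) c (E : set P2) (f : P2 -> \bar R) :
  a != 0 -> measurable E -> measurable_fun setT f -> (forall x, 0 <= f x)%E ->
  (\int[mu2]_(x in affine2 a c @^-1` E) f (affine2 a c x) =
   (a ^- 2)%:E * \int[mu2]_(x in E) f x)%E.
Proof.
move=> a0 mE mf f0; have na0 : 0 < a ^- 2 by rewrite invr_gt0 exprn_even_gt0.
pose phi : P2 -> P2 := affine2 a c.
have mphi : measurable_fun setT phi by exact: affine2_measurable.
have mfE : measurable_fun E f by exact: measurable_funTS.
transitivity (\int[pushforward mu2 phi]_(x in E) f x)%E.
  by rewrite ge0_integral_pushforward.
rewrite -(ge0_integral_mscale mu2 mE (NngNum (ltW na0)))//.
apply: eq_measure_integral => //= A mA _.
rewrite /pushforward /mscale/=; exact: plane_measure_affine.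
Qed.

(** Used for reflections ([a = -1]) and for dilations.  The positive and the
    negative part of [f] are transported separately. *)
Lemma Rintegral_affine2 (a : R) c (E : set P2) (f : P2 -> R) :
  a != 0 -> measurable E -> (mu2 E < +oo)%E -> bounded_measurable f ->
  Rintegral mu2 (affine2 a c @^-1` E) (f \o affine2 a c) =
   a ^- 2 * Rintegral mu2 E f.
Proof.
move=> a0 mE Eoo bf; rewrite /Rintegral.
have fi := bmeas_integrable mE Eoo bf.
have mf : measurable_fun setT (EFin \o f) by apply/measurable_EFinP; case: bf.
rewrite integralE [X in _ = _ * fine X]integralE.
have ep := ge0_integral_affine2 c a0 mE (measurable_funepos mf) (funepos_ge0 _).
have en := ge0_integral_affine2 c a0 mE (measurable_funeneg mf) (funeneg_ge0 _).
rewrite [X in fine (X - _)%E = _](_ : _ =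
  (\int[mu2]_(x in affine2 a c @^-1` E) ((EFin \o f)^\+ (affine2 a c x)))%E); last first.
  by apply: eq_integral => x _; rewrite !funeposE.
rewrite [X in fine (_ - X)%E = _](_ : _ =
  (\int[mu2]_(x in affine2 a c @^-1` E) ((EFin \o f)^\- (affine2 a c x)))%E); last first.
  by apply: eq_integral => x _; rewrite !funenegE.
rewrite ep en -muleBr//; last first.
  by apply: fin_num_adde_defr; exact: (integrable_pos_fin_num mE fi).
rewrite fineM// fin_numB.
by rewrite (integrable_pos_fin_num mE fi) (integrable_neg_fin_num mE fi).
Qed.

Definition unit_square : set (R * R) := `[0%R, 1%R[ `*` `[0%R, 1%R[.

Lemma unit_square_measurable : measurable (unit_square : set P2). Proof. exact: measurableX. Qed.

Lemma unit_square_measure : mu2 unit_square = 1%E.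
Proof.
transitivity (mu `[0%R, 1%R[ * mu `[0%R, 1%R[)%E.
  exact: product_measure1E.
rewrite !lebesgue_measure_itv/= lte_fin ltr01.
by rewrite -EFinB subr0 mule1.
Qed.

Lemma unit_square_lty : (mu2 unit_square < +oo)%E.
Proof. by rewrite unit_square_measure ltry. Qed.

Definition integer_box (K : nat) : seq (int * int) :=
  let r := [seq (n%:Z - K%:Z)%R | n <- iota 0 (2 * K).+1] in
  [seq (i, j) | i <- r, j <- r].

Lemma integer_box_uniq K : uniq (integer_box K).
Proof.
have u : uniq [seq (n%:Z - K%:Z)%R | n <- iota 0 (2 * K).+1].
  by rewrite map_inj_uniq ?iota_uniq// => i j /addIr[].
by apply: allpairs_uniq => // -[i j] [k l].
Qed.

Lemma mem_integer_box (K : nat) (k : int * int) :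
  `|k.1%:~R : R| <= K%:R -> `|k.2%:~R : R| <= K%:R -> k \in integer_box K.
Proof.
have H (z : int) : `|z%:~R : R| <= K%:R ->
    z \in [seq (n%:Z - K%:Z)%R | n <- iota 0 (2 * K).+1].
  move=> zK; apply/mapP; exists (absz (z + K%:Z)).
    rewrite mem_iota/= add0n ltnS.
    move: zK; rewrite -intr_norm (_ : K%:R = K%:Z%:~R)// ler_int; lia.
  move: zK; rewrite -intr_norm (_ : K%:R = K%:Z%:~R)// ler_int; lia.
by case: k => i j /= iK jK; apply: allpairs_f; exact: H.
Qed.

Lemma unit_square_tile (z : R * R) : exists2 k : int * int, unit_square (z + intpair k) &
  forall l, unit_square (z + intpair l) -> l = k.
Proof.
have H (x : R) : exists2 k : int, 0 <= x + k%:~R < 1 &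
    forall l : int, 0 <= x + l%:~R < 1 -> l = k.
  exists (- Num.floor x).
    have /andP[x0 x1] := floor_itv x.
    by move: x1; rewrite !intrD => x1; rewrite intrN; apply/andP; split; lra.
  move=> l /andP[l0 l1]; apply/eqP; rewrite -eqr_oppLR; apply/eqP/esym.
  apply: floor_def; rewrite intrD !intrN; apply/andP; split; lra.
have [k1 k1z k1u] := H z.1; have [k2 k2z k2u] := H z.2.
exists (k1, k2).
  by split; rewrite /= in_itv/=.
by move=> [l1 l2] [/=]; rewrite !in_itv/= => /k1u -> /k2u ->.
Qed.

(** Unfolding: the substitution [x := u - y + k] carries the [k]-th summand to an
    integral over a translate of the unit square, and these translates tile the
    plane.  The sum is over any finite list [r] containing every [k] that
    contributes, so that linearity of the integral is enough. *)
Lemma unfold_torus_integral (E : set P2) (u : R * R) (H : P2 -> R) (r : seq (int * int)) :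
  measurable E -> (mu2 E < +oo)%E -> bounded_measurable H ->
  (forall (x : R * R) (k : int * int), H (x + intpair k) = H x) ->
  uniq r -> (forall x k, unit_square x -> E (u - x + intpair k) -> k \in r) ->
  Rintegral mu2 unit_square (fun x => (\sum_(k <- r) \1_E (u - x + intpair k)) * H x) =
  Rintegral mu2 E (fun y => H (u - y)).
Proof.
move=> mE Eoo bH perH ur rE.
pose phi k : P2 -> P2 := affine2 (-1) (u + intpair k).
have phiE k x : phi k x = u - x + intpair k.
  by rewrite /phi /affine2; congr pair => /=; rewrite !mulN1r addrC addrAC.
have phiK k x : phi k (phi k x) = x.
  rewrite !phiE; case: x => x1 x2; congr pair => /=; ring.
have mphi k : measurable_fun setT (phi k) by exact: affine2_measurable.
have mpre k (A : set P2) : measurable A -> measurable (phi k @^-1` A).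
  by move=> mA; rewrite -[X in measurable X]setTI; exact: mphi.
have bcomp (f : P2 -> R) k : bounded_measurable f -> bounded_measurable (f \o phi k).
  move=> [mf [M fM]]; split; first exact: measurableT_comp.
  by exists M => x; exact: fM.
have bHu : bounded_measurable (fun y : P2 => H (u - y) : R).
  have -> : (fun y : P2 => H (u - y)) = H \o phi (0, 0).
    by apply/funext => y /=; rewrite phiE perH.
  exact: bcomp.
pose f (y : P2) : R := \1_E y * H (u - y).
have bf : bounded_measurable f by apply: bmeasM => //; exact: bmeas_indic.
have term k : Rintegral mu2 unit_square (fun x => \1_E (u - x + intpair k) * H x) =
    Rintegral mu2 (phi k @^-1` unit_square) f.
  transitivity (Rintegral mu2 (phi k @^-1` (phi k @^-1` unit_square)) (f \o phi k)).
    have -> : phi k @^-1` (phi k @^-1` unit_square) = unit_square.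
      by apply/seteqP; split => x /=; rewrite phiK.
    congr Rintegral; apply/funext => x; rewrite /f /= phiE; congr (_ * _).
    rewrite -[LHS](perH _ (- k.1, - k.2)); congr H.
    by case: x => x1 x2; congr pair => /=; rewrite intrN; ring.
  rewrite Rintegral_affine2//.
  - by rewrite sqrrN expr1n invr1 mul1r.
  - by apply: mpre; exact: unit_square_measurable.
  - have N10 : -1 != 0 :> R by rewrite oppr_eq0 oner_eq0.
    have := plane_measure_affine (u + intpair k) N10 unit_square_measurable.
    rewrite unit_square_measure sqrrN expr1n invr1 mule1 => E1.
    exact: (eq_ind_r (fun x => (x < +oo)%E) (ltry 1) E1).
under eq_Rintegral do rewrite mulr_suml.
rewrite Rintegral_sum; last 2 first.
- exact: unit_square_measurable.
- move=> k; apply: bmeas_integrable; first exact: unit_square_measurable.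
    exact: unit_square_lty.
  apply: bmeasM => //.
  have -> : (fun x : P2 => \1_E (u - x + intpair k) : R) = (\1_E : P2 -> R) \o phi k.
    by apply/funext => y /=; rewrite phiE.
  by apply: bcomp; exact: bmeas_indic.
under eq_bigr do rewrite term.
transitivity (\sum_(k <- r) Rintegral mu2 E (fun y => \1_(phi k @^-1` unit_square) y * H (u - y))).
  apply: eq_bigr => k _.
  rewrite Rintegral_mkcond [RHS]Rintegral_mkcond; congr Rintegral; apply/funext => y.
  rewrite /patch /f !indicE; case: (y \in E); case: (y \in _) => //=;
  by rewrite ?mul1r ?mul0r.
rewrite -Rintegral_sum//; last first.
  move=> k; apply: bmeas_integrable => //; apply: bmeasM => //.
  by apply: bmeas_indic; apply: mpre; exact: unit_square_measurable.
apply: eq_Rintegral => y; rewrite inE => Ey.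
rewrite -mulr_suml.
(* Exactly one cell contains the point, and it belongs to the list. *)
have [k kQ kuniq] := unit_square_tile (u - y).
have kr : k \in r.
  apply: (rE _ _ kQ).
  suff -> : u - (u - y + intpair k) + intpair k = y by [].
  by rewrite [LHS]surjective_pairing [RHS]surjective_pairing; congr pair => /=; ring.
rewrite (bigD1_seq k)//= big1 ?addr0.
  by rewrite indicE mem_set ?mul1r//= phiE.
move=> l lk; rewrite indicE memNset//= phiE => /kuniq lk'.
by rewrite lk' eqxx in lk.
Qed.

End unfold.
Arguments unit_square {R}.
Arguments unit_square_measurable {R}.
Arguments unit_square_lty {R}.

(** * A kernel with spectrum in [0, 1] that is positive far out *)

Section kernel.
Context (R : realType).
Notation mu := (@lebesgue_measure R).

Lemma Rintegral_FTC2 (f F : R -> R) (a b : R) : a < b -> continuous f ->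
  (forall x : R, is_derive x 1 F (f x)) -> Rintegral mu `[a, b] f = F b - F a.
Proof.
move=> ab cf dF; have cF : continuous F.
  by move=> x; apply/differentiable_continuous/derivable1_diffP; case: (dF x).
rewrite /Rintegral (@continuous_FTC2 R f F a b)//.
- exact: continuous_subspaceT.
- split; first by move=> x _; case: (dF x).
  + exact/cvg_at_right_filter/cF.
  + exact/cvg_at_left_filter/cF.
- by move=> x _; rewrite derive1E derive_val.
Qed.


(** The factor l^2 is the Jacobian of the dilation by l, and (1 - l)^3 the weight
    of the average.  The triple zero at 1 is needed below: with a double zero the
    oscillating terms of the kernel would be as large as the main one. *)
Definition radial_weight (l : R) : R := l ^+ 2 * (1 - l) ^+ 3.

Definition radial_kernel (v : R) : R := Rintegral mu `[0, 1] (fun l => radial_weight l * - sin (l * v)).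

(** Repeated integration by parts.  The value 2 of the second derivative of the
    weight at 0 produces the main term 2 / v^3; at 1 the first derivative that
    does not vanish is the third, so all other terms are O(v^-4). *)
Lemma radial_kernelE (v : R) : v != 0 -> radial_kernel v =
  2 / v ^+ 3 - 6 * sin v / v ^+ 4 - 48 * cos v / v ^+ 5 - 72 / v ^+ 5 + 120 * sin v / v ^+ 6.
Proof.
move=> v0.
(* [h0], ..., [h4] are the weight and its first four derivatives; the fifth is
   the constant -120, and [G] is the antiderivative found by parts. *)
pose h0 (l : R) := l ^+ 2 * (1 - l) ^+ 3.
pose h1 (l : R) := 2 * l - 9 * l ^+ 2 + 12 * l ^+ 3 - 5 * l ^+ 4.
pose h2 (l : R) := 2 - 18 * l + 36 * l ^+ 2 - 20 * l ^+ 3.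
pose h3 (l : R) := - 18 + 72 * l - 60 * l ^+ 2.
pose h4 (l : R) := 72 - 120 * l.
pose c (l : R) := cos (l * v).
pose s (l : R) := sin (l * v).
pose G (l : R) := (h0 l / v - h2 l / v ^+ 3 + h4 l / v ^+ 5) * c l +
  (h3 l / v ^+ 4 - h1 l / v ^+ 2 + 120 / v ^+ 6) * s l.
have cs (f : R -> R) : (forall x : R, derivable f x 1) -> continuous f.
  by move=> df x; apply/differentiable_continuous/derivable1_diffP.
have dG (x : R) : is_derive x 1 G (radial_weight x * - sin (x * v)).
  rewrite /G /h0 /h1 /h2 /h3 /h4 /c /s; apply: is_derive_eq.
  rewrite /radial_weight /GRing.scale/=; field => //.
have ch : continuous (fun l => radial_weight l * - sin (l * v)).
  by apply: cs => x; rewrite /radial_weight; apply: ex_derive.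
rewrite /radial_kernel (Rintegral_FTC2 ltr01 ch dG).
rewrite /G /h0 /h1 /h2 /h3 /h4 /c /s !mul0r cos0 sin0 !mul1r.
by field.
Qed.

Lemma radial_kernel_ge (v : R) : 20 <= v -> v ^- 3 <= radial_kernel v.
Proof.
move=> v20; have v0 : 0 < v by apply: lt_le_trans v20.
rewrite radial_kernelE ?gt_eqF//.
have -> : 2 / v ^+ 3 - 6 * sin v / v ^+ 4 - 48 * cos v / v ^+ 5 - 72 / v ^+ 5
   + 120 * sin v / v ^+ 6 = v ^- 3 + (v ^+ 3 - 6 * sin v * v ^+ 2
     - 48 * cos v * v - 72 * v + 120 * sin v) / v ^+ 6.
  by field; rewrite gt_eqF.
rewrite lerDl divr_ge0//; last by rewrite exprn_ge0// ltW.
have s1 := sin_le1 v; have s2 := sin_geN1 v.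
have c1 := cos_le1 v.
have sv : sin v * v ^+ 2 <= v ^+ 2 by rewrite ler_piMl// sqr_ge0.
have cv : cos v * v <= v by rewrite ler_piMl// ltW.
have vv : 20 * v <= v ^+ 2 by rewrite expr2 ler_pM2r.
have vvv : 20 * v ^+ 2 <= v ^+ 3 by rewrite (exprS _ 2) ler_pM2r// exprn_gt0.
lra.
Qed.


Lemma cos_addz2pi (x : R) (k : int) : cos (x + 2 * pi * k%:~R) = cos x.
Proof.
have H (y : R) (n : nat) : cos (y + 2 * pi * n%:R) = cos y.
  rewrite (_ : y + _ = y + pi *+ 2 *+ n); first by rewrite periodicn//; exact: cosD2pi.
  by rewrite -[pi *+ 2 *+ n]mulr_natr -[pi *+ 2]mulr_natr; ring.
case: (intP k) => [|n|n]; first by rewrite mulr0 addr0.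
  exact: H.
rewrite intrN mulrN; set y := x - _.
by rewrite -(H y n.+1) /y subrK.
Qed.

Lemma unit_interval_lty : (mu `[0%R, 1%R[ < +oo)%E.
Proof. by rewrite lebesgue_measure_itv/= lte_fin ltr01 -EFinB ltry. Qed.

Lemma integral_cos_unit (k : int) (c : R) : k != 0 ->
  Rintegral mu `[0, 1[ (fun t => cos (2 * pi * k%:~R * t + c)) = 0.
Proof.
move=> k0; have w0 : 2 * pi * k%:~R != 0 :> R.
  by rewrite !mulf_neq0 ?intr_eq0// gt_eqF// pi_gt0.
set w := 2 * pi * k%:~R in w0 *.
have cc : continuous (fun t : R => cos (w * t + c)).
  move=> x; apply/differentiable_continuous/derivable1_diffP; exact: ex_derive.
rewrite Rintegral_itv_bndo_bndc; last first.
  apply: (@bmeas_integrable _ (measurableTypeR R)) => //.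
    exact: unit_interval_lty.
  by apply: bmeas_cos; exact: affine_measurable.
have dF (x : R) : is_derive x 1 (fun t => sin (w * t + c) / w) (cos (w * x + c)).
  apply: is_derive_eq; rewrite /GRing.scale/=; field => //.
rewrite (Rintegral_FTC2 ltr01 cc dF) mulr0 mulr1 add0r.
suff -> : sin (w + c) = sin c by rewrite subrr.
by rewrite -!cosBpihalf (addrC w) addrAC cos_addz2pi.
Qed.

Notation mu2 := (mu \x mu)%E.
Notation P2 := (measurableTypeR R * measurableTypeR R)%type.

(** Fubini, integrating first in a coordinate whose frequency is not zero. *)
Lemma integral_cos_torus (k : int * int) (c : R) : k != (0, 0) ->
  Rintegral mu2 unit_square (fun x : R * R => cos (2 * pi * (k.1%:~R * x.1 + k.2%:~R * x.2) + c)) = 0.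
Proof.
move=> k0.
pose f (x : P2) : R := \1_unit_square x * cos (2 * pi * (k.1%:~R * (x.1 : R) + k.2%:~R * (x.2 : R)) + c).
have lin_meas : measurable_fun setT (fun x : P2 =>
    2 * pi * (k.1%:~R * (x.1 : R) + k.2%:~R * (x.2 : R)) + c : R).
  apply: measurable_funD => //; apply: measurable_funM => //.
  by apply: measurable_funD; apply: measurable_funM.
have bf : bounded_measurable f.
  by apply: bmeasM; [apply: bmeas_indic; exact: unit_square_measurable|exact: bmeas_cos].
have fi : mu2.-integrable setT (EFin \o f).
  have := bmeas_integrable (@unit_square_measurable R) (@unit_square_lty R) bf.
  move/(integrable_mkcond _ (@unit_square_measurable R)).
  apply: eq_integrable => // x _; rewrite /patch /f /= indicE.
  by case: (x \in unit_square); rewrite // mul0r.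
have -> : Rintegral mu2 unit_square (fun x : R * R => cos (2 * pi * (k.1%:~R * x.1 + k.2%:~R * x.2) + c))
   = Rintegral mu2 setT f.
  rewrite [LHS]Rintegral_mkcond; congr Rintegral; apply/funext => x.
  by rewrite /patch /f indicE; case: (x \in unit_square); rewrite ?mul1r ?mul0r.
have I1 (w : int) d : w != 0 -> (\int[mu]_(t in `[0%R, 1%R[) (cos (2 * pi * w%:~R * t + d))%:E = 0)%E.
  move=> w0; rewrite -[LHS]fineK.
    congr EFin; exact: integral_cos_unit.
  have mI : measurable (`[0%R, 1%R[ : set (measurableTypeR R)) by [].
  apply: (integrable_fin_num mI).
  apply: (@bmeas_integrable _ (measurableTypeR R)) => //.
    exact: unit_interval_lty.
  by apply: bmeas_cos; exact: affine_measurable.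
have QE (x y : R) : \1_unit_square (x, y) = \1_`[0%R, 1%R[ x * \1_`[0%R, 1%R[ y :> R.
  rewrite !indicE -natrM mulnb; congr (_%:R); congr nat_of_bool.
  by apply/idP/andP; rewrite !inE => -[].
have I0 (g : R -> R) (x : R) (w : int) d : w != 0 ->
    (forall y, g y = \1_`[0%R, 1%R[ x * \1_`[0%R, 1%R[ y * cos (2 * pi * w%:~R * y + d)) ->
    (\int[mu]_y (g y)%:E = 0)%E.
  move=> w0 gE; have [xI|xI] := boolP (x \in `[0%R, 1%R[%classic); last first.
    by apply: integral0_eq => y _; rewrite gE indicE (negbTE xI) !mul0r.
  rewrite -(I1 w d w0) [RHS]integral_mkcond; apply: eq_integral => y _.
  rewrite gE /patch !indicE xI mul1r.
  by case: (y \in _); rewrite ?mul1r ?mul0r.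
rewrite /Rintegral.
have [k2|k2] := eqVneq k.2 0; last first.
  rewrite -(integral12_prod_meas1 fi) /fubini_F.
  rewrite integral0_eq// => x _.
  apply: (I0 _ x k.2 (2 * pi * k.1%:~R * x + c) k2) => y.
  rewrite /f QE /=; congr (_ * cos _); ring.
have k1 : k.1 != 0.
  by apply: contra k0 => /eqP k1; apply/eqP; rewrite (surjective_pairing k) k1 k2.
rewrite -(integral21_prod_meas1 fi) /fubini_G.
rewrite integral0_eq// => y _.
apply: (I0 _ y k.1 (2 * pi * k.2%:~R * y + c) k1) => x.
rewrite /f QE /= [\1_ _ x * _]mulrC; congr (_ * cos _); ring.
Qed.

End kernel.

(** * Exponential sums of the point set *)

Section exponential_sums.
Context (R : realType).
Notation mu := (@lebesgue_measure R).
Notation mu2 := (mu \x mu)%E.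
Notation P2 := (measurableTypeR R * measurableTypeR R)%type.

Definition phase (k : int * int) (x : R * R) : R :=
  2 * pi * (k.1%:~R * x.1 + k.2%:~R * x.2).

Lemma phaseD k x y : phase k (x + y) = phase k x + phase k y.
Proof. rewrite /phase /=; ring. Qed.

Lemma phaseN k x : phase k (- x) = - phase k x.
Proof. rewrite /phase /=; ring. Qed.

Lemma phaseDl k l x : phase (k + l) x = phase k x + phase l x.
Proof. rewrite /phase /= !intrD; ring. Qed.

Lemma phaseNl k x : phase (- k) x = - phase k x.
Proof. rewrite /phase /= !intrN; ring. Qed.

Lemma phase_measurable k : measurable_fun setT (phase k : P2 -> R).
Proof.
apply: measurable_funM => //.
by apply: measurable_funD; apply: measurable_funM.
Qed.

Lemma cos_phase_period (k l : int * int) (x : R * R) c :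
  cos (phase k (x + intpair l) + c) = cos (phase k x + c).
Proof.
rewrite -[RHS](cos_addz2pi _ (k.1 * l.1 + k.2 * l.2)); congr cos.
rewrite /phase /= !intrD !intrM; ring.
Qed.

Variable u : seq (R * R).

Definition cos_sum k := \sum_(p <- u) cos (phase k p).
Definition sin_sum k := \sum_(p <- u) sin (phase k p).
Definition power_spectrum k := cos_sum k ^+ 2 + sin_sum k ^+ 2.
(** With S the exponential sum of [u] at [k], [power_spectrum k] is |S|^2 and
    [wave k c] is the real part of exp(i (phase k x + c)) times the conjugate of
    S. *)
Definition wave k c (x : R * R) := \sum_(p <- u) cos (phase k (x - p) + c).

Lemma power_ge0 k : 0 <= power_spectrum k.
Proof. by rewrite addr_ge0// sqr_ge0. Qed.

Lemma powerN k : power_spectrum (- k) = power_spectrum k.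
Proof.
rewrite /power_spectrum /cos_sum /sin_sum; congr (_ + _).
  by under eq_bigr do rewrite phaseNl cosN.
under eq_bigr do rewrite phaseNl sinN.
by rewrite sumrN sqrrN.
Qed.

Lemma waveE k c x : wave k c x =
  cos_sum k * cos (phase k x + c) + sin_sum k * sin (phase k x + c).
Proof.
rewrite /wave /cos_sum /sin_sum !mulr_suml -big_split/=; apply: eq_bigr => p _.
by rewrite phaseD phaseN addrAC cosB mulrC [sin _ * sin _]mulrC.
Qed.

Lemma wave_sqr_le k c x : wave k c x ^+ 2 <= power_spectrum k.
Proof.
rewrite waveE /power_spectrum -subr_ge0.
set a := cos_sum k; set b := sin_sum k; set z := phase k x + c.
suff -> : a ^+ 2 + b ^+ 2 - (a * cos z + b * sin z) ^+ 2 = (a * sin z - b * cos z) ^+ 2.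
  exact: sqr_ge0.
transitivity ((a ^+ 2 + b ^+ 2) * (cos z ^+ 2 + sin z ^+ 2) - (a * cos z + b * sin z) ^+ 2).
  by rewrite cos2Dsin2 mulr1.
ring.
Qed.

Lemma wave_period k c x l : wave k c (x + intpair l) = wave k c x.
Proof.
rewrite /wave; apply: eq_bigr => p _.
by rewrite addrAC cos_phase_period.
Qed.

Lemma bmeas_wave k c : bounded_measurable (wave k c : P2 -> R).
Proof.
apply: (@bmeas_sum _ P2) => p; apply: (@bmeas_cos _ P2).
apply: (@measurable_funD _ P2) => //.
under eq_fun do rewrite phaseD.
by apply: (@measurable_funD _ P2) => //; exact: phase_measurable.
Qed.

(** Summing over the points completes the conjugate of S to |S|^2, which does not
    depend on the phases; this is why the test functions are built from [wave]. *)
Lemma wave_sum_translates k c x :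
  \sum_(q <- u) wave k c (q - x) = power_spectrum k * cos (c - phase k x).
Proof.
rewrite /power_spectrum; set z := c - phase k x.
transitivity (\sum_(q <- u) (cos_sum k * (cos (phase k q) * cos z - sin (phase k q) * sin z)
    + sin_sum k * (sin (phase k q) * cos z + cos (phase k q) * sin z))).
  apply: eq_bigr => q _.
  rewrite waveE phaseD phaseN -addrA (addrC (- phase k x)) -/z.
  by rewrite cosD (sinD (phase k q)).
rewrite big_split/= -!mulr_sumr big_split/= big_split/= sumrN -!mulr_suml.
rewrite -/(cos_sum k) -/(sin_sum k); ring.
Qed.

Lemma integral_wave k c : k != (0, 0) -> Rintegral mu2 unit_square (wave k c) = 0.
Proof.
move=> k0; rewrite Rintegral_sum; last 2 first.
- exact: unit_square_measurable.
- move=> p; apply: bmeas_integrable; [exact: unit_square_measurable|exact: unit_square_lty|].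
  apply: (@bmeas_cos _ P2).
  apply: (@measurable_funD _ P2) => //.
  under eq_fun do rewrite phaseD.
  by apply: (@measurable_funD _ P2) => //; exact: phase_measurable.
rewrite big1// => p _.
rewrite -[RHS](integral_cos_torus (c - phase k p) k0); congr Rintegral; apply/funext => x.
by rewrite phaseD phaseN -addrA (addrC (- phase k p)).
Qed.

Lemma integral_wave_mul k l c d : l != k -> l != - k ->
  Rintegral mu2 unit_square (fun x => wave k c x * wave l d x) = 0.
Proof.
move=> lk lNk.
have kpl : k + l != (0, 0) by rewrite addrC addr_eq0.
have kml : k - l != (0, 0) by rewrite subr_eq0 eq_sym.
have bc (m : int * int) e : bounded_measurable (fun x : P2 => cos (phase m x + e)).
  by apply: (@bmeas_cos _ P2); apply: (@measurable_funD _ P2) => //; exact: phase_measurable.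
have ic (f : P2 -> R) : bounded_measurable f -> mu2.-integrable unit_square (EFin \o f).
  by apply: bmeas_integrable; [exact: unit_square_measurable|exact: unit_square_lty].
transitivity (Rintegral mu2 unit_square (fun x : P2 => \sum_(p <- u) \sum_(q <- u)
   2^-1 * (cos (phase (k + l) x + (c + d - phase k p - phase l q)) +
           cos (phase (k - l) x + (c - d - phase k p + phase l q))))).
  congr Rintegral; apply/funext => x; rewrite /wave mulr_suml.
  apply: eq_bigr => p _; rewrite mulr_sumr; apply: eq_bigr => q _.
  rewrite !phaseDl !phaseNl !phaseD !phaseN.
  set a := phase k x - phase k p + c; set b := phase l x - phase l q + d.
  rewrite (_ : _ + (c + d - phase k p - phase l q) = a + b); last by rewrite /a /b; ring.
  rewrite (_ : _ + (c - d - phase k p + phase l q) = a - b); last by rewrite /a /b; ring.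
  by rewrite cosD cosB; field.
rewrite Rintegral_sum; last 2 first.
- exact: unit_square_measurable.
- by move=> p; apply: ic; apply: (@bmeas_sum _ P2) => q; apply: (@bmeasM _ P2);
    [exact: bmeas_cst|exact: bmeasD].
rewrite big1// => p _.
rewrite Rintegral_sum; last 2 first.
- exact: unit_square_measurable.
- by move=> q; apply: ic; apply: (@bmeasM _ P2); [exact: bmeas_cst|exact: bmeasD].
rewrite big1// => q _.
rewrite RintegralZl; last 2 first.
- exact: unit_square_measurable.
- by apply: ic; exact: bmeasD.
rewrite RintegralD; last 3 first.
- exact: unit_square_measurable.
- exact: ic.
- exact: ic.
by rewrite !(integral_cos_torus _ kpl, integral_cos_torus _ kml) addr0 mulr0.
Qed.

End exponential_sums.

(** * Testing the discrepancy against a trigonometric polynomial *)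

Section torus_inequality.
Context (R : realType).
Notation mu := (@lebesgue_measure R).
Notation mu2 := (mu \x mu)%E.
Notation P2 := (measurableTypeR R * measurableTypeR R)%type.
Variables (u : seq (R * R)) (I : finType) (m : I -> int * int) (th : I -> R).
Hypothesis m0 : forall i, m i != (0, 0).

Definition test_function (x : R * R) := \sum_i wave u (m i) (th i) x.

Lemma bmeas_test : bounded_measurable (test_function : P2 -> R).
Proof. by apply: (@bmeas_sum _ P2) => i; exact: bmeas_wave. Qed.

Lemma test_period x k : test_function (x + intpair k) = test_function x.
Proof. by apply: eq_bigr => i _; exact: wave_period. Qed.

Let iQ (f : P2 -> R) : bounded_measurable f -> mu2.-integrable unit_square (EFin \o f).
Proof. by apply: bmeas_integrable; [exact: unit_square_measurable|exact: unit_square_lty]. Qed.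

Lemma integral_test : Rintegral mu2 unit_square test_function = 0.
Proof.
rewrite Rintegral_sum; last 2 first.
- exact: unit_square_measurable.
- by move=> i; apply: iQ; exact: bmeas_wave.
by rewrite big1// => i _; exact: integral_wave.
Qed.

(** By orthogonality only pairs with [m j = m i] or [m j = - m i] contribute, at
    most [2 * K] for each [i]; for these the two waves have the same power, which
    bounds their product pointwise. *)
Lemma integral_test_sqr_le (K : nat) :
  (forall k, #|[pred i | m i == k]| <= K)%N ->
  Rintegral mu2 unit_square (fun x => test_function x ^+ 2) <= (2 * K)%:R * \sum_i power_spectrum u (m i).
Proof.
move=> mK.
have bww i j : bounded_measurable (fun x : P2 => wave u (m i) (th i) x * wave u (m j) (th j) x).
  by apply: (@bmeasM _ P2); exact: bmeas_wave.
have -> : Rintegral mu2 unit_square (fun x => test_function x ^+ 2) =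
    \sum_i \sum_j Rintegral mu2 unit_square (fun x => wave u (m i) (th i) x * wave u (m j) (th j) x).
  transitivity (Rintegral mu2 unit_square (fun x : P2 =>
      \sum_i \sum_j wave u (m i) (th i) x * wave u (m j) (th j) x)).
    congr Rintegral; apply/funext => x; rewrite expr2 {1}/test_function mulr_suml.
    by apply: eq_bigr => i _; rewrite mulr_sumr.
  rewrite Rintegral_sum; last 2 first.
  - exact: unit_square_measurable.
  - by move=> i; apply: iQ; exact: bmeas_sum.
  apply: eq_bigr => i _; rewrite Rintegral_sum//; first exact: unit_square_measurable.
  by move=> j; exact: iQ.
rewrite mulr_sumr; apply: ler_sum => i _.
have term j : Rintegral mu2 unit_square (fun x => wave u (m i) (th i) x * wave u (m j) (th j) x) <=
    ((m j == m i) + (m j == - m i))%:R * power_spectrum u (m i).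
  have [/norP[ji jNi]|] := boolP (~~ ((m j == m i) || (m j == - m i))).
    by rewrite integral_wave_mul// (negbTE ji) (negbTE jNi) mul0r.
  rewrite negbK => mji.
  have pji : power_spectrum u (m j) = power_spectrum u (m i).
    by case/orP: mji => /eqP ->; rewrite ?powerN.
  apply: (@le_trans _ _ (power_spectrum u (m i))); last first.
    by rewrite ler_peMl ?power_ge0// ler1n; case/orP: mji => ->; rewrite ?addn1.
  apply: (@le_trans _ _ (Rintegral mu2 unit_square (cst (power_spectrum u (m i))))).
    apply: le_Rintegral; first exact: unit_square_measurable.
    - exact: iQ.
    - by apply: iQ; exact: bmeas_cst.
    move=> x _ /=.
    have := wave_sqr_le u (m i) (th i) x; have := wave_sqr_le u (m j) (th j) x.
    rewrite pji; set a := wave _ _ _ _; set b := wave _ _ _ _ => aP bP.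
    have := sqr_ge0 (a - b); rewrite sqrrB => ab.
    lra.
  rewrite Rintegral_cst; last exact: unit_square_measurable.
  by rewrite (_ : fine _ = 1) ?mulr1// (_ : _ unit_square = 1%E)//; exact: unit_square_measure.
apply: (le_trans (ler_sum _ (fun j _ => term j))).
rewrite -mulr_suml ler_wpM2r ?power_ge0// -natr_sum ler_nat big_split/=.
have cnt k : (\sum_j (m j == k) <= K)%N.
  apply: leq_trans (mK k); rewrite -sum1_card [leqRHS]big_mkcond/=.
  by apply: leq_sum => j _; rewrite inE; case: eqP.
by rewrite mul2n -addnn leq_add.
Qed.

Variables (E : set P2) (r : seq (int * int)) (K0 : R).
Hypotheses (mE : measurable E) (Eoo : (mu2 E < +oo)%E) (ur : uniq r).
Hypothesis Er : forall q x k, q \in u -> unit_square x -> E (q - x + intpair k) -> k \in r.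

Definition discrepancy (x : R * R) : R :=
  \sum_(q <- u) \sum_(k <- r) \1_E (q - x + intpair k) - K0.

Lemma bmeas_count q : bounded_measurable (fun x : P2 => \sum_(k <- r) \1_E (q - x + intpair k) : R).
Proof.
apply: (@bmeas_sum _ P2) => k.
have -> : (fun x : P2 => \1_E (q - x + intpair k) : R) =
    (\1_E : P2 -> R) \o (affine2 (-1) (q + intpair k) : P2 -> P2).
  apply/funext => y /=; congr (\1_E _); congr pair => /=; ring.
have [mf [M fM]] := bmeas_indic R mE.
split; last by exists M => x; exact: fM.
by apply: measurableT_comp => //; exact: affine2_measurable.
Qed.

Lemma bmeas_discrepancy : bounded_measurable (discrepancy : P2 -> R).
Proof.
apply: (@bmeasB _ P2); last exact: bmeas_cst.
by apply: (@bmeas_sum _ P2) => q; exact: bmeas_count.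
Qed.

Definition cosine_transform i := Rintegral mu2 E (fun y => cos (th i - phase (m i) y)).

(** The constant [K0] is orthogonal to the test function, and unfolding turns the
    sum over the points into the power spectrum. *)
Lemma integral_discrepancy_test :
  Rintegral mu2 unit_square (fun x => discrepancy x * test_function x) = \sum_i power_spectrum u (m i) * cosine_transform i.
Proof.
have bt := bmeas_test.
transitivity (Rintegral mu2 unit_square (fun x : P2 => \sum_(q <- u)
    ((\sum_(k <- r) \1_E (q - x + intpair k)) * test_function x) - K0 * test_function x)).
  by congr Rintegral; apply/funext => x; rewrite /discrepancy mulrBl mulr_suml.
rewrite RintegralB; last 3 first.
- exact: unit_square_measurable.
- apply: iQ; apply: (@bmeas_sum _ P2) => q; apply: (@bmeasM _ P2) => //; exact: bmeas_count.
- by apply: iQ; apply: (@bmeasM _ P2) => //; exact: bmeas_cst.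
rewrite RintegralZl; last 2 first.
- exact: unit_square_measurable.
- exact: iQ.
rewrite integral_test mulr0 subr0 Rintegral_sum; last 2 first.
- exact: unit_square_measurable.
- by move=> q; apply: iQ; apply: (@bmeasM _ P2) => //; exact: bmeas_count.
transitivity (\sum_(q <- u) Rintegral mu2 E (fun y => test_function (q - y))).
  rewrite big_seq [RHS]big_seq; apply: eq_bigr => q qu.
  apply: unfold_torus_integral => //; first exact: test_period.
  by move=> x k; exact: Er.
have btr q : bounded_measurable (fun y : P2 => test_function (q - y)).
  have -> : (fun y : P2 => test_function (q - y)) = (test_function : P2 -> R) \o (affine2 (-1) q : P2 -> P2).
    apply/funext => y /=; congr test_function; congr pair => /=; ring.
  case: bt => mf [M fM].
  split; last by exists M => x; exact: fM.
  by apply: measurableT_comp => //; exact: affine2_measurable.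
rewrite -Rintegral_sum//; last by move=> q; exact: bmeas_integrable.
transitivity (Rintegral mu2 E (fun y : P2 => \sum_i power_spectrum u (m i) * cos (th i - phase (m i) y))).
  congr Rintegral; apply/funext => y; rewrite /test_function exchange_big/=.
  by apply: eq_bigr => i _; exact: wave_sum_translates.
have bc i : bounded_measurable (fun y : P2 => cos (th i - phase (m i) y)).
  apply: (@bmeas_cos _ P2); apply: (@measurable_funB _ P2) => //.
  exact: phase_measurable.
rewrite Rintegral_sum//; last first.
  move=> i; apply: bmeas_integrable => //; apply: (@bmeasM _ P2) => //; exact: bmeas_cst.
apply: eq_bigr => i _; rewrite RintegralZl//; exact: bmeas_integrable.
Qed.

(** The integral of [(discrepancy - tau * test_function)^2] is nonnegative.  The
    set [Z] allows [f] to be the squared discrepancy of a set that is equal to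
    [E] only up to a null set. *)
Lemma torus_inequality (K : nat) (tau : R) (f : R * R -> \bar R) (Z : set P2) :
  (forall k, #|[pred i | m i == k]| <= K)%N ->
  measurable Z -> mu2 Z = 0%E -> (forall x, unit_square x -> 0 <= f x)%E ->
  (forall x, unit_square x -> ~ Z x -> f x = (discrepancy x ^+ 2)%:E) ->
  ((2 * tau * (\sum_i power_spectrum u (m i) * cosine_transform i)
    - tau ^+ 2 * ((2 * K)%:R * \sum_i power_spectrum u (m i)))%:E <= \int[mu2]_(x in unit_square) f x)%E.
Proof.
move=> mK mZ Z0 f0 fD.
have bt := bmeas_test; have bd := bmeas_discrepancy.
pose g x := 2 * tau * (discrepancy x * test_function x) - tau ^+ 2 * (test_function x ^+ 2).
have bdt : bounded_measurable (fun x : P2 => discrepancy x * test_function x) by exact: (@bmeasM _ P2).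
have btt : bounded_measurable (fun x : P2 => test_function x ^+ 2) by exact: (@bmeasM _ P2).
have b1 : bounded_measurable (fun x : P2 => 2 * tau * (discrepancy x * test_function x)).
  by apply: (@bmeasM _ P2) => //; exact: bmeas_cst.
have b2 : bounded_measurable (fun x : P2 => tau ^+ 2 * (test_function x ^+ 2)).
  by apply: (@bmeasM _ P2) => //; exact: bmeas_cst.
have bg : bounded_measurable (g : P2 -> R) by exact: (@bmeasB _ P2).
apply: (@le_trans _ _ (Rintegral mu2 unit_square g)%:E).
  rewrite lee_fin /g RintegralB; last 3 first.
  - exact: unit_square_measurable.
  - exact: iQ.
  - exact: iQ.
  rewrite !RintegralZl; last 4 first.
  - exact: unit_square_measurable.
  - exact: iQ.
  - exact: unit_square_measurable.
  - exact: iQ.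
  rewrite integral_discrepancy_test lerD2l lerN2 ler_wpM2l ?sqr_ge0//.
  exact: integral_test_sqr_le.
apply: (integrable_le_lower_integral _ mZ Z0) => //; first exact: unit_square_measurable.
  exact: iQ.
move=> x Qx Zx; rewrite fD// lee_fin /g -subr_ge0.
suff -> : discrepancy x ^+ 2 - (2 * tau * (discrepancy x * test_function x) - tau ^+ 2 * test_function x ^+ 2)
    = (discrepancy x - tau * test_function x) ^+ 2 by exact: sqr_ge0.
ring.
Qed.

End torus_inequality.

(** * Exponential sums are large on average over a box of frequencies *)

Section fejer.
Context (R : realType).
Variables (u : seq (R * R)) (X : nat).

Notation cell := ('I_X * 'I_X)%type.

Definition lattice (n : cell) : int * int := ((n.1 : nat)%:Z, (n.2 : nat)%:Z).

Lemma lattice_inj : injective lattice.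
Proof. by move=> [a b] [c d] [/= ac bd]; congr pair; apply/val_inj. Qed.

(** Frequencies are indexed by the ordered pairs of distinct lattice points of an
    [X] by [X] square, rather than by the differences of these pairs.  Summing
    over the index then amounts to summing with the coefficients of a Fejer
    kernel, and a given frequency occurs at most [X ^ 2] times. *)
Definition offdiag : {pred cell * cell} := [pred q | q.1 != q.2].
Definition freqs := {q : cell * cell | q \in offdiag}.
Definition freq (q : freqs) : int * int := lattice (val q).1 - lattice (val q).2.

Lemma freq_neq0 q : freq q != (0, 0).
Proof. by rewrite subr_eq0 (inj_eq lattice_inj); exact: valP q. Qed.

Lemma freq_mult k : (#|[pred q | freq q == k]| <= X ^ 2)%N.
Proof.
have inj : {in [pred q | freq q == k] &, injective (fun q : freqs => (val q).2)}.
  move=> q q'; rewrite !inE => /eqP qk /eqP q'k qq'.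
  apply/val_inj; rewrite (surjective_pairing (val q)) (surjective_pairing (val q')) qq'.
  congr pair; apply: lattice_inj; apply: (addIr (- lattice (val q').2)).
  by rewrite -{1}qq' -/(freq q) -/(freq q') qk q'k.
rewrite -(card_in_image inj) (leq_trans (max_card _))//.
by rewrite card_prod card_ord mulnn.
Qed.

Lemma freq_le q : (`|(freq q).1| <= X /\ `|(freq q).2| <= X)%N.
Proof.
case: q => -[[a b] [c d]] ?; rewrite /freq /lattice/=.
have := ltn_ord a; have := ltn_ord b; have := ltn_ord c; have := ltn_ord d.
by move=> *; split; lia.
Qed.

Lemma power_double k : power_spectrum u k = \sum_(p <- u) \sum_(p' <- u) cos (phase k (p - p')).
Proof.
rewrite /power_spectrum /cos_sum /sin_sum !expr2 !mulr_suml -big_split/=; apply: eq_bigr => p _.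
rewrite !mulr_sumr -big_split/=; apply: eq_bigr => p' _.
by rewrite phaseD phaseN cosB.
Qed.

(** Expanding |S|^2 as a double sum over the points [p], [p'] and exchanging the
    sums gives the squared modulus of sum_n exp(2 i pi n.(p - p')).  These are
    nonnegative, and equal to [X ^ 4] when [p = p']. *)
Lemma sum_power_all :
  (size u)%:R * (X ^ 4)%:R <= \sum_(n : cell) \sum_(n' : cell) power_spectrum u (lattice n - lattice n').
Proof.
pose S z : R := \sum_(n : cell) \sum_(n' : cell) cos (phase (lattice n - lattice n') z).
have SE z : S z = (\sum_(n : cell) cos (phase (lattice n) z)) ^+ 2 +
     (\sum_(n : cell) sin (phase (lattice n) z)) ^+ 2.
  rewrite /S !expr2 !mulr_suml -big_split/=; apply: eq_bigr => n _.
  rewrite !mulr_sumr -big_split/=; apply: eq_bigr => n' _.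
  by rewrite phaseDl phaseNl cosB.
have S0 z : 0 <= S z by rewrite SE addr_ge0// sqr_ge0.
have -> : \sum_(n : cell) \sum_(n' : cell) power_spectrum u (lattice n - lattice n') =
    \sum_(p <- u) \sum_(p' <- u) S (p - p').
  under eq_bigr do under eq_bigr do rewrite power_double.
  under eq_bigr do rewrite exchange_big/=.
  rewrite exchange_big/=; apply: eq_bigr => p _.
  under eq_bigr do rewrite exchange_big/=.
  by rewrite exchange_big/=.
rewrite mulr_natl -[in leLHS]sum1_size -sumrMnr big_seq [leRHS]big_seq ler_sum// => p pu.
rewrite (big_rem p)//= ler_wpDr//; first by rewrite sumr_ge0.
rewrite subrr SE /phase /=.
under eq_bigr do rewrite !mulr0 addr0 mulr0 cos0.
under [X in _ + X ^+ 2]eq_bigr do rewrite !mulr0 addr0 mulr0 sin0.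
rewrite [X in _ + X ^+ 2]big1// expr0n addr0 sumr_const card_prod card_ord.
by rewrite mulr1n -natrX mulnn -expnM.
Qed.

Lemma sum_power_freqs :
  (size u)%:R * (X ^ 4)%:R - (size u ^ 2 * X ^ 2)%:R <= \sum_(q : freqs) power_spectrum u (freq q).
Proof.
have p0 : power_spectrum u 0 = (size u ^ 2)%:R.
  have ph x : phase 0 x = 0 :> R by rewrite /phase /= !mul0r addr0 mulr0.
  rewrite /power_spectrum /cos_sum /sin_sum.
  under eq_bigr do rewrite ph cos0.
  under [X in _ + X ^+ 2]eq_bigr do rewrite ph sin0.
  by rewrite [X in _ + X ^+ 2]big1// expr0n addr0 big_const_seq count_predT iter_addr_0 natrX.
rewrite lerBlDr; apply: le_trans sum_power_all _.
rewrite pair_big/= (bigID (mem offdiag))/= lerD//.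
  by rewrite (big_sub offdiag (fun q => power_spectrum u (lattice q.1 - lattice q.2))).
rewrite (eq_bigr (fun=> power_spectrum u 0)); last first.
  by move=> q; rewrite negbK => /eqP ->; rewrite subrr.
rewrite sumr_const p0 natrM -[leLHS]mulr_natr ler_wpM2l// ler_nat.
have inj : {in [pred q | q \notin offdiag] &, injective (fun q : cell * cell => q.1)}.
  by move=> [a b] [c d]; rewrite !inE !negbK/= => /eqP -> /eqP -> ->.
rewrite -(card_in_image inj) (leq_trans (max_card _))//.
by rewrite card_prod card_ord mulnn.
Qed.

End fejer.

(** * Averages over the dilation parameter *)

Section dilations.
Context (R : realType).
Notation mu := (@lebesgue_measure R).
Notation mu2 := (mu \x mu)%E.
Notation T1 := (measurableTypeR R).
Notation P2 := (measurableTypeR R * measurableTypeR R)%type.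

Lemma dilate_preimage (l : R) (E : set (R * R)) : l != 0 ->
  affine2 l 0 @^-1` dilate l E = E.
Proof.
move=> l0; apply/seteqP; split => x /=.
  move=> [y Ey yx]; suff -> : x = y by [].
  move: yx => -[/= /eqP + /eqP]; rewrite !addr0 !(inj_eq (mulfI l0)) => /eqP y1 /eqP y2.
  by case: x y {Ey} y1 y2 => ? ? [? ?] /= -> ->.
by move=> Ex; exists x => //; congr pair => /=; rewrite addr0.
Qed.

Lemma dilateE (l : R) (E : set (R * R)) : l != 0 ->
  dilate l E = affine2 l^-1 0 @^-1` E.
Proof.
move=> l0; apply/seteqP; split => x /=.
  move=> [y Ey <-]; suff -> : affine2 l^-1 0 (l *: y) = y by [].
  by case: y {Ey} => y1 y2; congr pair; rewrite /= addr0 mulKf.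
move=> Ex; exists (affine2 l^-1 0 x) => //.
by case: x {Ex} => x1 x2; congr pair; rewrite /= addr0 [LHS]mulVKf.
Qed.

Lemma dilate_measurable (l : R) (E : set P2) : l != 0 -> measurable E ->
  measurable (dilate l E : set P2).
Proof.
move=> l0 mE; rewrite dilateE// -[X in measurable X]setTI.
exact: affine2_measurable.
Qed.

Lemma dilate_measure (l : R) (E : set P2) : l != 0 -> measurable E ->
  mu2 (dilate l E) = ((l ^+ 2)%:E * mu2 E)%E.
Proof.
move=> l0 mE; rewrite dilateE// plane_measure_affine ?invr_eq0//.
by rewrite exprVn invrK.
Qed.

Lemma dilate_lty (l : R) (E : set P2) : l != 0 -> measurable E -> (mu2 E < +oo)%E ->
  (mu2 (dilate l E) < +oo)%E.
Proof.
move=> l0 mE Eoo; have -> := dilate_measure l0 mE.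
by rewrite lte_mul_pinfty// lee_fin sqr_ge0.
Qed.

Lemma Rintegral_dilate (l : R) (E : set P2) (f : P2 -> R) : l != 0 -> measurable E ->
  (mu2 E < +oo)%E -> bounded_measurable f ->
  Rintegral mu2 (dilate l E) f = l ^+ 2 * Rintegral mu2 E (fun x => f (affine2 l 0 x)).
Proof.
move=> l0 mE Eoo bf.
have := Rintegral_affine2 0 l0 (dilate_measurable l0 mE) (dilate_lty l0 mE Eoo) bf.
rewrite dilate_preimage// => ->.
by rewrite mulrA mulfV ?expf_neq0// mul1r.
Qed.

(** A name for the product measure, to which sigma-finiteness can be attached;
    Fubini's theorem on R * (R * R) requires it. *)
Definition plane_measure : set P2 -> \bar R := mu2.

HB.instance Definition _ := Measure.on plane_measure.

Let plane_sigma_finite : sigma_finite setT plane_measure.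
Proof.
have /sigma_finiteP[F [TF ndF Foo]] := sigma_finiteT mu.
exists (fun n => F n `*` F n).
  rewrite -setXTT TF predeqE => -[x y]; split.
    move=> [/= [n _ Fnx] [k _ Fky]]; exists (maxn n k) => //; split.
    - by move: x Fnx; exact/subsetPset/ndF/leq_maxl.
    - by move: y Fky; exact/subsetPset/ndF/leq_maxr.
  by move=> [n _ []/= ? ?]; split; exists n.
move=> k; have [? ?] := Foo k.
split; first exact: measurableX.
have -> : plane_measure (F k `*` F k) = (mu (F k) * mu (F k))%E.
  exact: product_measure1E.
by rewrite lte_mul_pinfty// ge0_fin_numE.
Qed.

HB.instance Definition _ :=
  Measure_isSigmaFinite.Build _ _ _ plane_measure plane_sigma_finite.

Notation nu := plane_measure.

Variables (E : set P2) (v : P2 -> R).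
Hypotheses (mE : measurable E) (Eoo : (mu2 E < +oo)%E) (mv : measurable_fun setT v).

Let I01 : set T1 := `[0%R, 1%R]%classic.
Let mI01 : measurable I01. Proof. exact: measurable_itv. Qed.

Definition radial_transform (l : R) := radial_weight l * Rintegral mu2 E (fun y => - sin (l * v y)).

Let f (z : T1 * P2) : R := (\1_I01 z.1 * radial_weight z.1) * (\1_E z.2 * - sin ((z.1 : R) * v z.2)).

Let I01_lty : (mu I01 < +oo)%E.
Proof. by rewrite lebesgue_measure_itv/= lte_fin ltr01 -EFinB ltry. Qed.

Let bmeas_radial_weight : bounded_measurable (fun l : T1 => \1_I01 l * radial_weight l : R).
Proof.
split.
  apply: (@measurable_funM _ T1); first exact: measurable_indic.
  by rewrite /radial_weight; apply: measurable_funM; apply: measurable_funX => //; apply: measurable_funB.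
exists 1 => l; rewrite indicE; case: (boolP (l \in I01)) => [|_]; last by rewrite mul0r normr0.
rewrite inE /I01/= in_itv/= => /andP[l0 l1]; rewrite mul1r /radial_weight normrM !normrX.
rewrite !ger0_norm// ?subr_ge0//.
by rewrite mulr_ile1 ?exprn_ge0 ?exprn_ile1 ?subr_ge0// gerBl.
Qed.

Let bf : bounded_measurable f.
Proof.
have [m1 [M1 f1]] := bmeas_radial_weight.
apply: bmeasM.
  split; first exact: (measurableT_comp m1 measurable_fst).
  by exists M1 => z; exact: f1.
apply: bmeasM.
  have [m2 [M2 f2]] := bmeas_indic R mE.
  split; first exact: (measurableT_comp m2 measurable_snd).
  by exists M2 => z; exact: f2.
apply: bmeasN; apply: bmeas_sin; apply: measurable_funM; first exact: measurable_fst.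
exact: (measurableT_comp mv measurable_snd).
Qed.

Let fi : (mu \x nu)%E.-integrable setT (EFin \o f).
Proof.
have mD : measurable (I01 `*` E : set (T1 * P2)) by exact: measurableX.
have Doo : ((mu \x nu)%E (I01 `*` E) < +oo)%E.
  have -> : (mu \x nu)%E (I01 `*` E) = (mu I01 * nu E)%E by exact: product_measure1E.
  by rewrite lte_mul_pinfty// ge0_fin_numE.
have := bmeas_integrable mD Doo bf.
move/(integrable_mkcond _ mD); apply: eq_integrable => // z _.
rewrite /patch /f /=; case: ifPn => //; rewrite notin_setE /= => /not_andP[] h.
  by rewrite indicE memNset// !mul0r.
by rewrite [X in _ * (X * _)]indicE memNset// mul0r mulr0.
Qed.

Let FE (l : R) : fubini_F nu (EFin \o f) l = (\1_I01 l * radial_transform l)%:E.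
Proof.
rewrite /fubini_F /f /= /radial_transform.
have b : bounded_measurable (fun y : P2 => - sin (l * v y)).
  by apply: bmeasN; apply: bmeas_sin; apply: measurable_funM.
transitivity (\int[mu2]_(y in E) (\1_I01 l * radial_weight l * - sin (l * v y))%:E)%E.
  rewrite [RHS]integral_mkcond; apply: eq_integral => y _.
  by rewrite /patch [\1_E y]indicE; case: (y \in E); rewrite ?mul1r// mul0r mulr0.
rewrite (mulrA (\1_I01 l) (radial_weight l)) -(RintegralZl _ mE); last exact: bmeas_integrable.
rewrite /Rintegral fineK//; apply: (integrable_fin_num mE).
by apply: bmeas_integrable => //; apply: bmeasM => //; exact: bmeas_cst.
Qed.

Let GE (y : P2) : fubini_G mu (EFin \o f) y = (\1_E y * radial_kernel (v y))%:E.
Proof.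
rewrite /fubini_G /f /= /radial_kernel.
have ih : mu.-integrable I01 (EFin \o (fun l => radial_weight l * - sin (l * v y))).
  have bh : bounded_measurable (fun l : T1 => \1_I01 l * radial_weight l * - sin ((l : R) * v y)).
    apply: bmeasM; first exact: bmeas_radial_weight.
    by apply: bmeasN; apply: bmeas_sin; apply: measurable_funM.
  have := bmeas_integrable mI01 I01_lty bh; apply: eq_integrable => // l.
  by move=> lI; rewrite /= indicE lI mul1r.
transitivity (\int[mu]_(l in I01) (\1_E y * (radial_weight l * - sin (l * v y)))%:E)%E.
  rewrite [RHS]integral_mkcond; apply: eq_integral => l _.
  rewrite /patch [\1_I01 l]indicE; case: (l \in I01); rewrite ?mul1r ?mul0r//.
  by rewrite mulrCA.
rewrite -(RintegralZl _ mI01 ih) /Rintegral fineK//; apply: (integrable_fin_num mI01).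
exact: (integrableZl mI01 _ ih).
Qed.

Lemma integrable_radial_transform : mu.-integrable I01 (EFin \o radial_transform).
Proof.
have := integrable_fubini_F fi.
have -> : fubini_F nu (EFin \o f) = (EFin \o radial_transform) \_ I01.
  apply/funext => l; rewrite FE /patch indicE.
  by case: (l \in I01); rewrite ?mul1r ?mul0r.
by move/(integrable_mkcond _ mI01).
Qed.

(** Fubini turns the mean over [l] into the integral over [E] of
    [radial_kernel (v y)], which is nonnegative on [E] and at least [21 ^- 3]
    where [v y <= 21]. *)
Lemma radial_transform_ge : (forall y, E y -> 20 <= v y) ->
  21 ^- 3 * fine (mu2 (E `&` [set y | v y <= 21])) <=
  Rintegral mu I01 radial_transform.
Proof.
move=> v20.
pose S : set P2 := E `&` [set y | v y <= 21].
have mS : measurable S.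
  apply: measurableI => //; rewrite -[X in measurable X]setTI.
  have -> : [set y | v y <= 21] = v @^-1` `]-oo, 21].
    by apply/seteqP; split => y /=; rewrite in_itv.
  exact: mv.
have Soo : (mu2 S < +oo)%E.
  by apply: le_lt_trans Eoo; apply: le_measure; rewrite ?inE//; exact: subIsetl.
have AE : (Rintegral mu I01 radial_transform)%:E = (\int[nu]_y (\1_E y * radial_kernel (v y))%:E)%E.
  rewrite /Rintegral fineK; last first.
    by apply: (integrable_fin_num mI01); exact: integrable_radial_transform.
  transitivity (\int[mu]_l fubini_F nu (EFin \o f) l)%E.
    rewrite integral_mkcond; apply: eq_integral => l _; rewrite FE /patch indicE.
    by case: (l \in I01); rewrite ?mul1r ?mul0r.
  rewrite (integral12_prod_meas1 fi) -(integral21_prod_meas1 fi).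
  by apply: eq_integral => y _; rewrite GE.
have SE : (21 ^- 3 * fine (mu2 S))%:E = (\int[nu]_y (21 ^- 3 * \1_S y)%:E)%E.
  under eq_integral do rewrite EFinM.
  rewrite ge0_integralZl_EFin//; last first.
    by apply/measurable_EFinP; exact: measurable_indic.
  rewrite integral_indic// setIT EFinM fineK//.
  by rewrite ge0_fin_numE.
rewrite -lee_fin AE SE; apply: le_lower_integral => y _.
  by rewrite lee_fin mulr_ge0// ?invr_ge0 ?exprn_ge0// indicE.
rewrite lee_fin.
rewrite !indicE.
have [yS|yS] := boolP (y \in S).
  move: yS; rewrite inE => -[Ey vy]; rewrite mem_set// mulr1 mul1r.
  apply: le_trans (radial_kernel_ge (v20 _ Ey)).
  have v0 : 0 < v y by apply: lt_le_trans (v20 _ Ey).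
  by rewrite lef_pV2 ?posrE ?exprn_gt0// lerXn2r// ?nnegrE// ltW.
rewrite mulr0; case: (boolP (y \in E)) => [|_]; last by rewrite mul0r.
rewrite inE mul1r => Ey; apply: le_trans (radial_kernel_ge (v20 _ Ey)).
by rewrite invr_ge0 exprn_ge0// (le_trans _ (v20 _ Ey)).
Qed.

End dilations.

(** * Interior and closure of a convex set *)

Section convexity.
Context (R : realType).
Implicit Types (C : set (R * R)) (p q : R * R).

Lemma convex_combination C p q (t : R) : convex_set C -> C p -> C q ->
  0 <= t -> t <= 1 -> C (t *: p + (1 - t) *: q).
Proof.
move=> cC Cp Cq t0 t1.
have := cC p q (Itv01 t0 t1); rewrite !inE => /(_ Cp Cq).
by [].
Qed.

Lemma bounded_box C : bounded_set C ->
  exists2 K : R, 0 < K & forall p, C p -> `|p.1| <= K /\ `|p.2| <= K.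
Proof.
move=> [M [Mreal MC]].
exists (`|M| + 1); first by rewrite ltr_wpDl.
move=> p Cp.
have : `|p| <= `|M| + 1.
  by apply: MC Cp; rewrite (le_lt_trans (ler_norm M))// ltrDl.
by rewrite prod_normE ge_max => /andP[].
Qed.

Lemma closure_box C (K : R) : (forall p, C p -> `|p.1| <= K /\ `|p.2| <= K) ->
  forall p, closure C p -> `|p.1| <= K /\ `|p.2| <= K.
Proof.
move=> CK p clp.
have H (e : R) : 0 < e -> `|p.1| <= K + e /\ `|p.2| <= K + e.
  move=> e0; have [q [/CK[q1 q2] [/= pq1 pq2]]] := clp _ (nbhsx_ballx p e e0).
  split.
    by rewrite -(subrK q.1 p.1) addrC (le_trans (ler_normD _ _))// lerD// ltW.
  by rewrite -(subrK q.2 p.2) addrC (le_trans (ler_normD _ _))// lerD// ltW.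
by split; apply/ler_addgt0Pr => e /H[].
Qed.

(** A segment with end points in the closure of [C], moved by the factor [th]
    towards a ball inside [C], stays in the interior together with a
    neighbourhood of size [th * r0].  A point of the closure is first replaced by
    a nearby point of [C], and the error is absorbed by the ball. *)
Lemma interior_tube C (Q A B : R * R) (r0 th t : R) : convex_set C ->
  ball Q r0 `<=` C -> closure C A -> closure C B -> 0 < th -> th < 1 ->
  0 <= t -> t <= 1 ->
  forall q, ball Q r0 q -> C° ((1 - th) *: (t *: A + (1 - t) *: B) + th *: q).
Proof.
move=> cC QC cA cB th0 th1 t0 t1 q Qq.
(* Room left in the ball, to absorb the displacement of the end points. *)
have sub q' : ball Q r0 q' -> exists2 e : R, 0 < e & ball q' e `<=` ball Q r0.
  by move=> Qq'; apply/nbhs_ballP; apply: open_nbhs_nbhs; split => //; exact: ball_open.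
have ballP (p p' : R * R) (e : R) : ball p e p' <-> `|p.1 - p'.1| < e /\ `|p.2 - p'.2| < e.
  by split=> -[].
have end_point z : closure C z -> forall q', ball Q r0 q' -> C ((1 - th) *: z + th *: q').
  move=> cz q' /sub[e e0 eQ].
  have d0 : 0 < e * th / (1 - th) by rewrite divr_gt0 ?mulr_gt0 ?subr_gt0.
  have [z' [Cz' /ballP[zz1 zz2]]] := cz _ (nbhsx_ballx z _ d0).
  pose q'' := q' + ((1 - th) / th) *: (z - z').
  have Cq'' : C q''.
    apply/QC/eQ/ballP; rewrite /q'' /=; split.
      rewrite opprD addNKr normrN normrM gtr0_norm ?divr_gt0 ?subr_gt0//.
      by rewrite -ltr_pdivlMl ?divr_gt0 ?subr_gt0// invf_div mulrC mulrA.
    rewrite opprD addNKr normrN normrM gtr0_norm ?divr_gt0 ?subr_gt0//.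
    by rewrite -ltr_pdivlMl ?divr_gt0 ?subr_gt0// invf_div mulrC mulrA.
  have := convex_combination cC Cq'' Cz' (ltW th0) (ltW th1).
  suff -> : th *: q'' + (1 - th) *: z' = (1 - th) *: z + th *: q' by [].
  rewrite /q'' [LHS]surjective_pairing [RHS]surjective_pairing.
  by congr pair; rewrite /= /GRing.scale/=; field; rewrite gt_eqF.
set z := t *: A + (1 - t) *: B.
have mid q' : ball Q r0 q' -> C ((1 - th) *: z + th *: q').
  move=> Qq'.
  have := convex_combination cC (end_point _ cA _ Qq') (end_point _ cB _ Qq') t0 t1.
  set lhs := (X in C X -> _); suff -> : lhs = (1 - th) *: z + th *: q' by [].
  rewrite /lhs /z [LHS]surjective_pairing [RHS]surjective_pairing.
  by congr pair; rewrite /= /GRing.scale/=; ring.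
have [e e0 eQ] := sub _ Qq.
apply/nbhs_ballP; exists (th * e) => /=; first exact: mulr_gt0.
move=> w /ballP[w1 w2].
set w0 := (1 - th) *: z + th *: q in w1 w2.
have -> : w = (1 - th) *: z + th *: (q + th^-1 *: (w - w0)).
  rewrite /w0 [LHS]surjective_pairing [RHS]surjective_pairing.
  by congr pair; rewrite /= /GRing.scale/=; field; rewrite gt_eqF.
apply/mid/eQ/ballP => /=; split.
  by rewrite opprD addNKr normrN normrM gtr0_norm ?invr_gt0// ltr_pdivrMl// distrC.
by rewrite opprD addNKr normrN normrM gtr0_norm ?invr_gt0// ltr_pdivrMl// distrC.
Qed.

End convexity.

(** * Plane curves of class C2 *)

Section curve.
Context (R : realType).
Notation mu := (@lebesgue_measure R).
Notation mu2 := (mu \x mu)%E.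
Notation P2 := (measurableTypeR R * measurableTypeR R)%type.

Lemma derivable_continuous (f : R -> R) : (forall s, derivable f s 1) -> continuous f.
Proof. by move=> df s; apply/differentiable_continuous/derivable1_diffP. Qed.

Lemma MVT_derive1 (f : R -> R) (s h : R) : (forall s, derivable f s 1) -> 0 < h ->
  exists2 c, s < c < s + h & f (s + h) - f s = h * derive1 f c.
Proof.
move=> df h0; have sh : s < s + h by rewrite ltrDl.
have [| |c] := @MVT R f (derive1 f) s (s + h) sh.
- by move=> x _; apply: DeriveDef => //; rewrite derive1E.
- exact/continuous_subspaceT/derivable_continuous.
by rewrite in_itv/= => cs ->; exists c => //; rewrite addrAC subrr add0r mulrC.
Qed.

Lemma lipschitz_of_derive1 (f : R -> R) (s t K : R) :
  (forall s, derivable f s 1) -> (forall s, `|derive1 f s| <= K) ->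
  `|f s - f t| <= K * `|s - t|.
Proof.
move=> df fK; wlog st : s t / t < s.
  move=> H; have [/H//|st|->] := ltgtP t s; last by rewrite !subrr normr0 mulr0.
  by rewrite distrC [ `|s - t| ]distrC; exact: H.
have st0 : 0 < s - t by rewrite subr_gt0.
have [c _] := MVT_derive1 t df st0; rewrite [t + _]addrC subrK => ->.
by rewrite normrM mulrC ler_wpM2r.
Qed.

(** The mean value theorem for [f], then for its derivative. *)
Lemma C2_increment (f : R -> R) (s h K : R) : C2 f -> 0 < h ->
  (forall t, s <= t <= s + h -> `|derive1n 2 f t| <= K) ->
  exists2 e, `|e| <= K * h & f (s + h) - f s = h * (derive1 f s + e).
Proof.
move=> [df ddf _] h0 fK.
have [c /andP[sc ch] ->] := MVT_derive1 s df h0.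
have cs0 : 0 < c - s by rewrite subr_gt0.
have [d /andP[sd dc]] := MVT_derive1 s ddf cs0.
rewrite [s + _]addrC subrK => cE.
rewrite addrC subrK in dc.
exists (derive1 f c - derive1 f s); last by rewrite addrC subrK.
have fd : `|derive1 (derive1 f) d| <= K.
  by apply: (fK d); apply/andP; split; [exact: ltW|apply/ltW/(lt_trans dc)].
rewrite cE normrM gtr0_norm// mulrC ler_pM// ltW//.
by rewrite ltrBlDr addrC.
Qed.

Lemma C2_bounded (f : R -> R) (a b : R) : C2 f -> a <= b ->
  exists2 K, 0 < K & forall t, a <= t <= b -> `|derive1n 2 f t| <= K.
Proof.
move=> [_ _ cf] ab.
have cn : {within `[a, b], continuous (fun t => `|derive1n 2 f t|)}.
  apply: continuous_subspaceT => t; apply: continuous_comp; first exact: cf.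
  exact: norm_continuous.
have [c _ cm] := EVT_max ab cn.
exists (`|derive1n 2 f c| + 1); first by rewrite ltr_wpDl.
by move=> t tab; rewrite (le_trans (cm t _)) ?in_itv// lerDl.
Qed.

Variables (L : R) (x y : R -> R).
Hypothesis L0 : 0 < L.
Hypothesis Cx : C2 x.
Hypothesis Cy : C2 y.
Hypothesis unit_speed : forall s, derive1 x s ^+ 2 + derive1 y s ^+ 2 = 1.

Lemma derive1_le1 s : `|derive1 x s| <= 1 /\ `|derive1 y s| <= 1.
Proof.
have sq (a b : R) : a ^+ 2 + b ^+ 2 = 1 -> `|a| <= 1.
  move=> ab; rewrite -(@ler_pXn2r _ 2)// ?nnegrE// expr1n real_normK ?num_real//.
  by rewrite -ab lerDl sqr_ge0.
by split; [exact: sq (unit_speed s)|apply: sq; rewrite addrC; exact: unit_speed].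
Qed.

(** The curve is 1-Lipschitz, so [n] arcs of length [L / n] are covered by [n]
    squares of side [2 * L / n], of total area [4 * L ^ 2 / n]. *)
Lemma curve_null (B : set P2) : measurable B ->
  (forall p, B p -> exists2 s, 0 <= s < L & p = (x s, y s)) -> mu2 B = 0%E.
Proof.
move=> mB BE.
have small (n : nat) : (mu2 B <= (4 * L ^+ 2 / n.+1%:R)%:E)%E.
  pose d := L / n.+1%:R.
  have d0 : 0 < d by rewrite divr_gt0.
  pose S (i : nat) : set P2 := `[x (i%:R * d) - d, x (i%:R * d) + d] `*`
                               `[y (i%:R * d) - d, y (i%:R * d) + d].
  have mS i : measurable (S i) by apply: measurableX; exact: measurable_itv.
  have muS i : mu2 (S i) = ((2 * d) ^+ 2)%:E.
    transitivity (mu `[(x (i%:R * d) - d)%R, (x (i%:R * d) + d)%R] *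
                  mu `[(y (i%:R * d) - d)%R, (y (i%:R * d) + d)%R])%E.
      by apply: product_measure1E; exact: measurable_itv.
    rewrite !lebesgue_measure_itv/= !lte_fin !ltrD2l gt0_cp//.
    by rewrite -!EFinB -EFinM; congr EFin; ring.
  have cover : B `<=` \big[setU/set0]_(i < n.+1) S i.
    move=> p /BE[s /andP[s0 sL] ->].
    pose i := Num.truncn (s / d).
    have /andP[i1 i2] : i%:R <= s / d < i.+1%:R.
      by apply: truncn_itv; rewrite divr_ge0// ltW.
    rewrite ler_pdivlMr// in i1; rewrite ltr_pdivrMr// in i2.
    have iN : (i < n.+1)%N.
      rewrite -(ltr_nat R) -(ltr_pM2r d0) (le_lt_trans i1)//.
      by rewrite /d mulrCA divff ?mulr1// pnatr_eq0.
    rewrite -bigcup_mkord; exists i => //=.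
    have si : `|s - i%:R * d| <= d.
      rewrite ger0_norm ?subr_ge0// lerBlDl; apply/ltW; apply: lt_le_trans i2 _.
      by rewrite -natr1 mulrDl mul1r.
    have [dx _ _] := Cx; have [dy _ _] := Cy.
    have := lipschitz_of_derive1 s (i%:R * d) dx (fun s => (derive1_le1 s).1).
    have := lipschitz_of_derive1 s (i%:R * d) dy (fun s => (derive1_le1 s).2).
    rewrite mul1r => /le_trans/(_ si) ys /le_trans/(_ si) xs.
    by split; rewrite /= in_itv/=; [move: xs|move: ys]; rewrite ler_distl.
  have mSi k : `I_n.+1 k -> measurable (S k) by move=> _; exact: mS.
  apply: (le_trans (content_subadditive _ mSi mB cover)).
  rewrite (eq_bigr (fun=> ((2 * d) ^+ 2)%:E)); last by move=> i _; exact: muS.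
  rewrite sumEFin lee_fin sumr_const card_ord -mulr_natr /d.
  rewrite le_eqVlt; apply/orP; left; apply/eqP; field.
  by rewrite addrC natr1 pnatr_eq0.
apply/eqP; rewrite eq_le measure_ge0 andbT.
apply/lee_addgt0Pr => e e0; rewrite add0e.
pose n := Num.truncn (4 * L ^+ 2 / e).
apply: le_trans (small n) _; rewrite lee_fin ler_pdivrMr// [e * _]mulrC -ler_pdivrMr//.
apply/ltW; exact: truncnS_gt.
Qed.

End curve.

(** * Area from below through sections *)

Section sections_area.
Context (R : realType).
Notation mu := (@lebesgue_measure R).
Notation mu2 := (mu \x mu)%E.
Notation P2 := (measurableTypeR R * measurableTypeR R)%type.

Let integral_block (a b h : R) : a < b -> 0 <= h ->
  (\int[mu]_X (2 * h * \1_(`[a, b]%classic : set R) X)%:E = (2 * h * (b - a))%:E)%E.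
Proof.
move=> ab h0; under eq_integral do rewrite EFinM.
rewrite ge0_integralZl_EFin//; last 2 first.
- by apply/measurable_EFinP; exact: measurable_indic.
- by rewrite mulr_ge0.
by rewrite integral_indic// setIT [X in (_ * X)%E]lebesgue_measure_itv/= lte_fin ab.
Qed.

Let section_measure (A : set R) (c h : R) : 0 <= h ->
  (forall Y, `|Y - c| < h -> A Y) -> measurable (A : set (measurableTypeR R)) ->
  ((2 * h)%:E <= mu A)%E.
Proof.
move=> h0 hA mA.
have <- : mu (ball c h) = (2 * h)%:E by rewrite lebesgue_measure_ball// mulr_natl.
apply: le_measure; rewrite ?inE//; first exact: measurable_ball.
by move=> Y; rewrite -ball_normE /= distrC; exact: hA.
Qed.

Lemma area_ge_xsections (S : set P2) (a b h : R) : measurable S -> a < b -> 0 <= h ->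
  (forall X, a <= X <= b -> exists c, forall Y, `|Y - c| < h -> S (X, Y)) ->
  ((2 * h * (b - a))%:E <= mu2 S)%E.
Proof.
move=> mS ab h0 H; rewrite -(integral_block ab h0); apply: le_lower_integral => X _.
  by rewrite lee_fin mulr_ge0// ?mulr_ge0// indicE.
rewrite indicE; case: (boolP (X \in _)) => [|_]; last by rewrite mulr0 measure_ge0.
rewrite inE /= in_itv/= => /H[c Hc]; rewrite mulr1.
apply: (section_measure h0); last exact: measurable_xsection.
by move=> Y /Hc; rewrite /xsection /= inE.
Qed.

Lemma area_ge_ysections (S : set P2) (a b h : R) : measurable S -> a < b -> 0 <= h ->
  (forall Y, a <= Y <= b -> exists c, forall X, `|X - c| < h -> S (X, Y)) ->
  ((2 * h * (b - a))%:E <= mu2 S)%E.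
Proof.
move=> mS ab h0 H.
have -> : mu2 S = (mu \x^ mu)%E S.
  by apply: product_measure_unique => // A B mA mB; exact: product_measure2E.
rewrite -(integral_block ab h0); apply: le_lower_integral => Y _.
  by rewrite lee_fin mulr_ge0// ?mulr_ge0// indicE.
rewrite indicE; case: (boolP (Y \in _)) => [|_]; last by rewrite mulr0 measure_ge0.
rewrite inE /= in_itv/= => /H[c Hc]; rewrite mulr1.
apply: (section_measure h0); last exact: measurable_ysection.
by move=> X /Hc; rewrite /ysection /= inE.
Qed.

End sections_area.

(** * Area of a thin strip along a supporting line *)

Section strip.
Context (R : realType).
Notation mu := (@lebesgue_measure R).
Notation mu2 := (mu \x mu)%E.
Notation P2 := (measurableTypeR R * measurableTypeR R)%type.
Variables (C : set (R * R)) (L : R) (x y : R -> R).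
Hypothesis L0 : 0 < L.
Hypothesis per : forall s, x (s + L) = x s /\ y (s + L) = y s.
Hypothesis Cx : C2 x.
Hypothesis Cy : C2 y.
Hypothesis unit_speed : forall s, derive1 x s ^+ 2 + derive1 y s ^+ 2 = 1.
Hypothesis bij : set_bij `[0, L[ (boundary C) (fun s => (x s, y s)).
Hypothesis convC : convex_set C.
Variables (K : R).
Hypothesis K0 : 0 < K.
Hypothesis CK : forall p, C p -> `|p.1| <= K /\ `|p.2| <= K.

Definition dot (xi p : R * R) : R := xi.1 * p.1 + xi.2 * p.2.

Lemma curve_onto p : boundary C p -> exists2 s, 0 <= s < L & p = (x s, y s).
Proof.
have [_ _ sur] := bij; move=> /sur[s]; rewrite /= in_itv/= => sL <-.
by exists s.
Qed.

Lemma curve_closure s : 0 <= s -> closure C (x s, y s).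
Proof.
move=> s0; pose n := Num.truncn (s / L).
have : s < L * n.+1%:R by rewrite mulrC -ltr_pdivrMr//; exact: truncnS_gt.
move: (n.+1) => m {n}; elim: m s s0 => [|m IH] s s0.
  by rewrite mulr0 ltNge s0.
have [sL _|Ls sm] := ltP s L.
  have [fun_ _ _] := bij; have : boundary C (x s, y s).
    by apply: fun_; rewrite /= in_itv/= s0.
  by case.
have := per (s - L); rewrite subrK => -[-> ->].
apply: IH; first by rewrite subr_ge0.
by rewrite ltrBlDr -[X in _ + X]mulr1 -mulrDr natr1.
Qed.

(** Along the ray from [p] in direction [- xi] the functional decreases; the last
    point of the ray in the closure of [C] is a boundary point. *)
Lemma exit_point xi p : xi != (0, 0) -> C p ->
  exists2 q, boundary C q & dot xi q <= dot xi p.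
Proof.
move=> xi0 Cp.
pose r := Num.max `|xi.1| `|xi.2|.
have r0 : 0 < r.
  rewrite lt_max !normr_gt0 -negb_and; apply: contra xi0 => /andP[/eqP a /eqP b].
  by rewrite (surjective_pairing xi) a b.
have clK := closure_box CK.
pose ray t := p - t *: xi.
pose T := [set t : R | 0 <= t /\ closure C (ray t)].
have T0 : T 0 by split => //; rewrite /ray scale0r subr0; exact: subset_closure.
have Tub : ubound T (2 * K / r).
  move=> t [t0 /clK[/= t1 t2]]; have [p1 p2] := CK Cp.
  rewrite ler_pdivlMr// -[t]ger0_norm// /r maxr_pMr// ge_max -!normrM.
  apply/andP; split.
    rewrite -[t * _](subKr p.1) (le_trans (ler_normB _ _))//; lra.
  rewrite -[t * _](subKr p.2) (le_trans (ler_normB _ _))//; lra.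
have Tsup : has_sup T by split; [exists 0|exists (2 * K / r)].
pose ts := sup T.
have ts0 : 0 <= ts by exact: sup_upper_bound.
have cont : continuous ray.
  move=> t; apply: cvgB; first exact: cvg_cst.
  by apply: cvgZr_tmp; exact: cvg_id.
have clts : closure C (ray ts).
  apply: (@closed_closure _ C (ray ts)).
  move=> B /cont Bts.
  have [t [[_ clt] Bt]] := closure_sup (proj1 Tsup) (proj2 Tsup) Bts.
  by exists (ray t).
exists (ray ts).
  split => // /nbhs_ballP[e /= e0 eC].
  have d0 : 0 < e / (2 * r) by rewrite divr_gt0// mulr_gt0.
  have : T (ts + e / (2 * r)).
    split; first by rewrite addr_ge0// ltW.
    apply/subset_closure/eC; rewrite /ray /ball/=.
    have nr z : `|z| <= r -> `|e / (2 * r) * z| < e.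
      move=> zr; rewrite normrM gtr0_norm// (le_lt_trans (ler_wpM2l (ltW d0) zr))//.
      have -> : e / (2 * r) * r = e / 2 by field; rewrite gt_eqF.
      by rewrite ltr_pdivrMr// ltr_pMr// ltr1n.
    have H (a b z : R) : `|z| <= r -> ball (a - b * z) e (a - (b + e / (2 * r)) * z).
      move=> zr; rewrite /ball/=.
      have -> : a - b * z - (a - (b + e / (2 * r)) * z) = e / (2 * r) * z by ring.
      exact: nr.
    split; apply: H; rewrite /r le_max lexx ?orbT//.
  move/(sup_upper_bound Tsup); rewrite -/ts gerDl leNgt d0//.
rewrite /ray /dot/= -subr_ge0.
suff -> : xi.1 * p.1 + xi.2 * p.2 - (xi.1 * (p.1 - ts * xi.1) + xi.2 * (p.2 - ts * xi.2))
   = ts * (xi.1 ^+ 2 + xi.2 ^+ 2) by rewrite mulr_ge0// addr_ge0// sqr_ge0.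
ring.
Qed.

(** A minimiser of [dot xi] along the boundary curve minimises it on [C] by
    [exit_point]; by periodicity it is an interior minimum of the parameter, which
    gives the critical equation even when it is attained at 0 or [L]. *)
Lemma support_point xi : xi != (0, 0) -> exists s0, [/\ 0 <= s0,
  s0 <= L, forall p, C p -> dot xi (x s0, y s0) <= dot xi p &
  xi.1 * derive1 x s0 + xi.2 * derive1 y s0 = 0].
Proof.
move=> xi0; have [dx _ _] := Cx; have [dy _ _] := Cy.
pose phi s := xi.1 * x s + xi.2 * y s.
have dphi (s : R) : is_derive s 1 phi (xi.1 * derive1 x s + xi.2 * derive1 y s).
  have ix : is_derive s 1 x (derive1 x s) by apply: DeriveDef => //; rewrite derive1E.
  have iy : is_derive s 1 y (derive1 y s) by apply: DeriveDef => //; rewrite derive1E.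
  by apply: is_derive_eq; rewrite /GRing.scale/=; ring.
have phid (s : R) : derivable phi s 1 by case: (dphi s).
have pper s : phi (s + L) = phi s by rewrite /phi; have [-> ->] := per s.
have cphi : {within `[0, L], continuous phi}.
  exact/continuous_subspaceT/derivable_continuous.
have [s0 s0L smin] := EVT_min (ltW L0) cphi.
move: (s0L); rewrite in_itv/= => /andP[s00 s0L'].
exists s0; split => //.
  move=> p Cp; have [q /curve_onto[s /andP[s1 s2] ->] qp] := exit_point xi0 Cp.
  by apply: le_trans qp; apply: smin; rewrite in_itv/= s1 ltW.
have ab : - L <= 2 * L by lra.
(* One more period on each side makes the minimum interior. *)
have s0in : s0 \in `]- L, (2 * L)[.
  rewrite in_itv/= (lt_le_trans _ s00) ?oppr_lt0//= (le_lt_trans s0L')//.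
  by rewrite mulr_natl mulr2n ltrDl.
have gmin t : t \in `]- L, (2 * L)[ -> phi s0 <= phi t.
  rewrite in_itv/= => /andP[t1 t2].
  have [t0|t0] := ltP t 0.
    by rewrite -(pper t); apply: smin; rewrite in_itv/=; apply/andP; split; lra.
  have [tL|tL] := leP t L; first by apply: smin; rewrite in_itv/= t0.
  rewrite -(subrK L t) pper; apply: smin; rewrite in_itv/=; apply/andP; split; lra.
have d0 := derive1_at_min ab (fun t _ => phid t) s0in gmin.
by have := @derive_val _ _ _ _ _ _ _ (dphi s0); rewrite (@derive_val _ _ _ _ _ _ _ d0).
Qed.

Definition strip xi a : set (R * R) := C° `&` [set p | dot xi p <= a + 1].

Lemma strip_measurable xi a : measurable (strip xi a : set P2).
Proof.
apply: measurableI; first by apply: open_measurable_plane; exact: open_interior.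
have md : measurable_fun setT (dot xi : P2 -> R).
  by apply: measurable_funD; apply: measurable_funM.
rewrite -[X in measurable X]setTI.
have -> : [set p | dot xi p <= a + 1] = dot xi @^-1` `]-oo, a + 1].
  by apply/seteqP; split => p /=; rewrite in_itv.
exact: md.
Qed.

(** Let [r] be the size of [xi].  Starting at the support point, follow the
    boundary over a length of order [r^(-1/2)]: the tangent there is orthogonal to
    [xi], so [dot xi] increases by at most a constant times [r * r^-1].  The chord
    of this arc, moved by a factor of order [r^-1] towards a ball contained in
    [C], sweeps a tube of that width which still lies in the strip.  The area of
    the tube is computed by sections along the axis on which the tangent has its
    larger coordinate. *)
Lemma strip_area : C° !=set0 -> exists2 c, 0 < c & forall xi : R * R,
  1 <= Num.max `|xi.1| `|xi.2| -> exists a, (forall p, C p -> a <= dot xi p) /\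
  ((c / (Num.max `|xi.1| `|xi.2| * Num.sqrt (Num.max `|xi.1| `|xi.2|)))%:E <=
    mu2 (strip xi a))%E.
Proof.
move=> [Q /nbhs_ballP[r0 /= r00 QC]].
have L20 : 0 <= 2 * L by rewrite mulr_ge0// ltW.
have [M1 M10 xM] := C2_bounded Cx L20; have [M2 M20 yM] := C2_bounded Cy L20.
pose M := Num.max M1 M2.
have M0 : 0 < M by rewrite lt_max M10.
(* [k] bounds the length of the arc: it makes the arc shorter than a period and
   keeps the variation of the unit tangent below 1/4 along it. *)
pose k := Num.min (Num.min 2^-1 L) (4 * M)^-1.
have k0 : 0 < k by rewrite !lt_min invr_gt0 ltr0n/= L0 invr_gt0 mulr_gt0.
have k12 : k <= 2^-1 by rewrite !ge_min lexx.
have kL : k <= L by rewrite !ge_min lexx orbT.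
have kM : M * k <= 4^-1.
  apply: (@le_trans _ _ (M * (4 * M)^-1)).
    by rewrite ler_pM2l// !ge_min lexx orbT.
  by rewrite invfM mulrCA divff ?mulr1// gt_eqF.
(* [k'] bounds the shift towards the ball, which costs at most 1/2 in [dot xi]. *)
pose k' := Num.min 2^-1 (8 * K)^-1.
have k'0 : 0 < k' by rewrite lt_min !invr_gt0 ltr0n mulr_gt0.
have k'2 : k' <= 2^-1 by rewrite ge_min lexx.
have k'K : 4 * k' * K <= 2^-1.
  apply: (@le_trans _ _ (4 * (8 * K)^-1 * K)).
    by rewrite ler_pM2r// ler_pM2l// ge_min lexx orbT.
  by rewrite le_eqVlt; apply/orP; left; apply/eqP; field; rewrite gt_eqF.
exists (k * k' * r0 / 4); first by rewrite divr_gt0// !mulr_gt0.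
move=> xi; set r := Num.max _ _ => r1.
have rgt0 : 0 < r by apply: lt_le_trans r1.
have xi1r : `|xi.1| <= r by rewrite le_max lexx.
have xi2r : `|xi.2| <= r by rewrite le_max lexx orbT.
have xi0 : xi != (0, 0).
  by apply: contraL rgt0 => /eqP xi0; rewrite /r xi0 normr0 maxxx ltxx.
have [s0 [s00 s0L supp crit]] := support_point xi0.
pose a := dot xi (x s0, y s0).
exists a; split=> //.
pose q := Num.sqrt r.
have q1 : 1 <= q by have := ler_wsqrtr r1; rewrite sqrtr1.
have q0 : 0 < q by apply: lt_le_trans q1.
have qq : q * q = r by rewrite -expr2 sqr_sqrtr// ltW.
pose sg := k / q.
have sg0 : 0 < sg by rewrite divr_gt0.
have sgk : sg <= k by rewrite ler_pdivrMr// ler_peMr// ltW.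
pose th := k' / r.
have th0 : 0 < th by rewrite divr_gt0.
have thk : th <= k' by rewrite ler_pdivrMr// ler_peMr// ltW.
have th1 : th < 1 by lra.
have inI t : s0 <= t <= s0 + sg -> 0 <= t <= 2 * L.
  by move=> /andP[t1 t2]; apply/andP; split; lra.
have [e1 e1M dx] := C2_increment Cx sg0 (fun t tI => xM t (inI t tI)).
have [e2 e2M dy] := C2_increment Cy sg0 (fun t tI => yM t (inI t tI)).
have sgM : M * sg <= 4^-1 by apply: le_trans kM; rewrite ler_pM2l.
have e1M' : `|e1| <= M * sg.
  by apply: (le_trans e1M); rewrite ler_pM2r// le_max lexx.
have e2M' : `|e2| <= M * sg.
  by apply: (le_trans e2M); rewrite ler_pM2r// le_max lexx orbT.
pose A := (x s0, y s0); pose B := (x (s0 + sg), y (s0 + sg)).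
have cA : closure C A by exact: curve_closure.
have cB : closure C B by apply: curve_closure; rewrite addr_ge0// ltW.
have dotle (u : R * R) (b : R) : `|u.1| <= b -> `|u.2| <= b -> dot xi u <= 2 * r * b.
  have H (z w : R) : `|z| <= r -> `|w| <= b -> z * w <= r * b.
    by move=> zr wb; rewrite (le_trans (ler_norm _))// normrM ler_pM.
  by move=> u1 u2; rewrite /dot -mulrA mulr_natl mulr2n lerD// H.
have dotB : dot xi B <= a + 2^-1.
  have -> : dot xi B = a + sg * (xi.1 * e1 + xi.2 * e2).
    have -> : sg * (xi.1 * e1 + xi.2 * e2) =
      xi.1 * (x (s0 + sg) - x s0) + xi.2 * (y (s0 + sg) - y s0).
      by rewrite dx dy -[LHS]addr0 -(mulr0 sg) -crit; ring.
    by rewrite /a /dot /=; ring.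
  rewrite lerD2l.
  apply: (@le_trans _ _ (sg * (2 * r * (M * sg)))).
    by rewrite ler_pM2l//; exact: (dotle (e1, e2)).
  have -> : sg * (2 * r * (M * sg)) = 2 * (M * k) * k.
    by rewrite /sg -qq; field; rewrite gt_eqF.
  apply: (@le_trans _ _ (2 * 4^-1 * k)); last by lra.
  by rewrite ler_pM2r// ler_pM2l.
have tube t p : 0 <= t <= 1 -> ball Q r0 p ->
    strip xi a ((1 - th) *: (t *: A + (1 - t) *: B) + th *: p).
  move=> /andP[t0 t1] Qp; split; first exact: interior_tube QC cA cB th0 th1 t0 t1 _ Qp.
  have [p1 p2] := CK (QC _ Qp); have [A1 A2] := closure_box CK cA.
  have pA : dot xi (p - A) <= 2 * r * (2 * K).
    by apply: dotle; rewrite /= (le_trans (ler_normB _ _))//; lra.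
  have thp : th * dot xi (p - A) <= 2^-1.
    apply: (@le_trans _ _ (th * (2 * r * (2 * K)))); first by rewrite ler_pM2l.
    have -> : th * (2 * r * (2 * K)) = 4 * k' * K by rewrite /th; field; rewrite gt_eqF.
    by [].
  rewrite /=.
  have -> : dot xi ((1 - th) *: (t *: A + (1 - t) *: B) + th *: p) =
    a + (1 - th) * ((1 - t) * (dot xi B - a)) + th * dot xi (p - A).
    by rewrite /a /dot /= /GRing.scale/=; ring.
  rewrite -addrA lerD2l.
  have h1 : (1 - t) * (dot xi B - a) <= 2^-1.
    apply: (@le_trans _ _ ((1 - t) * 2^-1)); last by lra.
    by rewrite ler_wpM2l ?subr_ge0// lerBlDl.
  have h2 : (1 - th) * ((1 - t) * (dot xi B - a)) <= 2^-1.
    apply: (@le_trans _ _ ((1 - th) * 2^-1)); last by lra.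
    by rewrite ler_wpM2l// subr_ge0 ltW.
  lra.
have mS := strip_measurable xi a.
have th1' : 2^-1 <= 1 - th by lra.
have area w : sg / 4 <= w -> k * k' * r0 / 4 / (r * q) <= 2 * (th * r0) * ((1 - th) * w).
  move=> sw; apply: (@le_trans _ _ (2 * (th * r0) * (2^-1 * (sg / 4)))).
    by rewrite le_eqVlt /th /sg; apply/orP; left; apply/eqP; field; rewrite !gt_eqF.
  rewrite ler_pM2l ?(mulr_gt0, th0, r00)// ler_pM//; first by rewrite divr_ge0// ltW.
have thr0 : 0 <= th * r0 by rewrite mulr_ge0// ltW.
(* The larger coordinate of the unit tangent is at least 1/2, so that coordinate
   moves by at least a quarter of the arc length. *)
have speed (d1 d2 e z1 z2 : R) : d1 ^+ 2 + d2 ^+ 2 = 1 -> `|z2| <= `|z1| -> 0 < `|z1| ->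
    z2 * d1 + z1 * d2 = 0 -> `|e| <= 4^-1 -> sg / 4 <= `|sg * (d1 + e)|.
  move=> d12 z21 z10 zd e4.
  have d21 : `|d2| <= `|d1|.
    rewrite -(ler_pM2l z10) -normrM.
    have -> : z1 * d2 = - (z2 * d1) by apply/eqP; rewrite -addr_eq0 addrC zd.
    by rewrite normrN normrM ler_wpM2r.
  have d1sq : 2^-1 ^+ 2 <= `|d1| ^+ 2.
    have : `|d2| ^+ 2 <= `|d1| ^+ 2 by rewrite lerXn2r// nnegrE.
    rewrite !real_normK ?num_real// => dd; rewrite expr2; lra.
  have d1h : 2^-1 <= `|d1| by rewrite -(@ler_pXn2r _ 2)// nnegrE.
  rewrite normrM (gtr0_norm sg0) ler_pM2l//.
  have := lerB_normD d1 e; lra.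
have between (X0 X1 X : R) : X0 != X1 -> Num.min X0 X1 <= X <= Num.max X0 X1 ->
    exists2 t, 0 <= t <= 1 & X = t * X1 + (1 - t) * X0.
  move=> X01 /andP[mX XM]; exists ((X - X0) / (X1 - X0)); last first.
    by field; rewrite subr_eq0 eq_sym.
  move: X01 mX XM; rewrite neq_lt minEle maxEle => /orP[X01|X01].
    rewrite (ltW X01) => mX XM.
    by apply/andP; split; rewrite ?ler_pdivrMr ?ler_pdivlMr ?subr_gt0//; lra.
  rewrite (leNgt X0 X1) X01/= => mX XM.
  have -> : (X - X0) / (X1 - X0) = (X0 - X) / (X0 - X1) by rewrite -[RHS]mulrNN -invrN !opprB.
  by apply/andP; split; rewrite ?ler_pdivrMr ?ler_pdivlMr ?subr_gt0//; lra.
have dist (X0 X1 : R) : Num.max X0 X1 - Num.min X0 X1 = `|X1 - X0|.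
  by rewrite minEle maxEle; case: leP => ?; [rewrite ger0_norm ?subr_ge0|
    rewrite ltr0_norm ?subr_lt0// opprB].
have ballP (p : R * R) : `|Q.1 - p.1| < r0 -> `|Q.2 - p.2| < r0 -> ball Q r0 p by [].
have e14 : `|e1| <= 4^-1 by exact: le_trans sgM.
have e24 : `|e2| <= 4^-1 by exact: le_trans sgM.
have sg40 : 0 < sg / 4 by rewrite divr_gt0.
have [x12|x21] := leP `|xi.1| `|xi.2|.
- have xr : 0 < `|xi.2| by move: rgt0; rewrite /r max_r.
  have wx : sg / 4 <= `|A.1 - B.1|.
    by rewrite distrC dx; apply: speed x12 xr crit e14; exact: unit_speed.
  pose X0 := (1 - th) * B.1 + th * Q.1; pose X1 := (1 - th) * A.1 + th * Q.1.
  have X01 : `|X1 - X0| = (1 - th) * `|A.1 - B.1|.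
    rewrite (_ : X1 - X0 = (1 - th) * (A.1 - B.1)); last by rewrite /X1 /X0; ring.
    by rewrite normrM gtr0_norm// subr_gt0.
  have X01n : X0 != X1.
    rewrite eq_sym -subr_eq0 -normr_gt0 X01 mulr_gt0 ?subr_gt0//; exact: lt_le_trans wx.
  apply: (@le_trans _ _ (2 * (th * r0) * (Num.max X0 X1 - Num.min X0 X1))%:E).
    by rewrite lee_fin dist X01; exact: area.
  apply: area_ge_xsections => //.
    by rewrite -subr_gt0 dist normr_gt0 subr_eq0 eq_sym.
  move=> X /(between _ _ _ X01n)[t t01 ->].
  exists ((1 - th) * (t * A.2 + (1 - t) * B.2) + th * Q.2) => Y Yc.
  set c := (X in `|_ - X|) in Yc.
  have := tube t (Q.1, Q.2 + (Y - c) / th) t01; rewrite /strip.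
  set z := (_ + th *: _); suff -> : z = (t * X1 + (1 - t) * X0, Y).
    apply; apply: ballP; rewrite /= ?subrr ?normr0// opprD addNKr normrN normrM.
    by rewrite normfV (gtr0_norm th0) ltr_pdivrMr// mulrC.
  rewrite /z [LHS]surjective_pairing; congr pair; rewrite /= /GRing.scale/=.
    by rewrite /X1 /X0 /A /B /=; ring.
  by rewrite /c /A /B /=; field; rewrite gt_eqF.
- have xr : 0 < `|xi.1| by apply: le_lt_trans x21.
  have wy : sg / 4 <= `|A.2 - B.2|.
    rewrite distrC dy; apply: (speed _ (derive1 x s0) e2 xi.1 xi.2) => //.
    - by rewrite addrC unit_speed.
    - exact: ltW.
    - by rewrite addrC.
  pose X0 := (1 - th) * B.2 + th * Q.2; pose X1 := (1 - th) * A.2 + th * Q.2.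
  have X01 : `|X1 - X0| = (1 - th) * `|A.2 - B.2|.
    rewrite (_ : X1 - X0 = (1 - th) * (A.2 - B.2)); last by rewrite /X1 /X0; ring.
    by rewrite normrM gtr0_norm// subr_gt0.
  have X01n : X0 != X1.
    rewrite eq_sym -subr_eq0 -normr_gt0 X01 mulr_gt0 ?subr_gt0//; exact: lt_le_trans wy.
  apply: (@le_trans _ _ (2 * (th * r0) * (Num.max X0 X1 - Num.min X0 X1))%:E).
    by rewrite lee_fin dist X01; exact: area.
  apply: area_ge_ysections => //.
    by rewrite -subr_gt0 dist normr_gt0 subr_eq0 eq_sym.
  move=> X /(between _ _ _ X01n)[t t01 ->].
  exists ((1 - th) * (t * A.1 + (1 - t) * B.1) + th * Q.1) => Y Yc.
  set c := (X in `|_ - X|) in Yc.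
  have := tube t (Q.1 + (Y - c) / th, Q.2) t01; rewrite /strip.
  set z := (_ + th *: _); suff -> : z = (Y, t * X1 + (1 - t) * X0).
    apply; apply: ballP; rewrite /= ?subrr ?normr0// opprD addNKr normrN normrM.
    by rewrite normfV (gtr0_norm th0) ltr_pdivrMr// mulrC.
  rewrite /z [LHS]surjective_pairing; congr pair; rewrite /= /GRing.scale/=.
    by rewrite /c /A /B /=; field; rewrite gt_eqF.
  by rewrite /X1 /X0 /A /B /=; ring.
Qed.

End strip.

(** * Counting points in translates of a set *)

Section counting.
Local Open Scope quotient_scope.
Context (R : realType).
Notation mu := (@lebesgue_measure R).
Notation mu2 := (mu \x mu)%E.
Notation P2 := (measurableTypeR R * measurableTypeR R)%type.

Definition points (P : {fset torus R}) : seq (R * R) := [seq repr t | t <- P].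

Lemma repr_pi (x : R * R) : exists j : int * int, repr (\pi_(torus R) x) = x + intpair j.
Proof.
have : \pi_(torus R) (repr (\pi_(torus R) x)) == \pi_(torus R) x by rewrite reprK.
rewrite eqmodE => /andP[/intrP[j1 e1] /intrP[j2 e2]].
exists (j1, j2); rewrite [LHS]surjective_pairing [RHS]surjective_pairing /=.
by congr pair; apply/eqP; rewrite addrC -subr_eq; apply/eqP.
Qed.

Lemma card_translateE (P : {fset torus R}) (S : set (R * R)) x (r : seq (int * int)) :
  uniq r -> (forall q k, q \in points P -> S (q - x + intpair k) -> k \in r) ->
  card_translate P S (\pi_(torus R) x) =
  \sum_(q <- points P) \sum_(k <- r) \1_S (q - x + intpair k).
Proof.
move=> ur Sr; rewrite /card_translate big_map big_seq [RHS]big_seq.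
apply: eq_bigr => t tP.
have [j ->] := repr_pi x.
rewrite (@reindex_fsbig _ _ _ _ _ (fun k : int * int => k + j) setT setT)/=; last first.
  split=> //; first by move=> a b _ _ /addIr.
  by move=> k _; exists (k - j) => //; rewrite subrK.
rewrite (eq_fsbigr (fun k => \1_S (repr t - x + intpair k))); last first.
  move=> k _; congr (\1_S _); rewrite [LHS]surjective_pairing [RHS]surjective_pairing /=.
  by congr pair; rewrite intrD; ring.
rewrite (fsbigE r)//; last first.
  move=> k _ kr; rewrite indicE memNset// => /Sr Sk.
  by move: kr; rewrite Sk//; apply/mapP; exists t.
by apply: eq_bigl => k; rewrite mem_set.
Qed.

End counting.

(** * The torus inequality for dilates of a convex body *)

Lemma null_bigsetU d (T : measurableType d) (R : realType)
    (m : {measure set T -> \bar R}) (I : Type) (s : seq I) (F : I -> set T) :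
  (forall i, measurable (F i)) -> (forall i, m (F i) = 0%E) ->
  m (\big[setU/set0]_(i <- s) F i) = 0%E.
Proof.
move=> mF F0; elim: s => [|i s IH]; first by rewrite big_nil measure0.
rewrite big_cons null_set_setU//; exact: bigsetU_measurable.
Qed.

Section energy.
Context (R : realType).
Notation mu := (@lebesgue_measure R).
Notation mu2 := (mu \x mu)%E.
Notation P2 := (measurableTypeR R * measurableTypeR R)%type.
Variables (C : set (R * R)) (K : R).
Hypothesis K0 : 0 < K.
Hypothesis CK : forall p, C p -> `|p.1| <= K /\ `|p.2| <= K.

Lemma interior_measurable : measurable (C° : set P2).
Proof. by apply: open_measurable_plane; exact: open_interior. Qed.

Lemma boundary_measurable : measurable (boundary C : set P2).
Proof.
apply: measurableD; last exact: interior_measurable.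
rewrite -(setCK (closure C)); apply: measurableC; apply: open_measurable_plane.
by apply: closed_openC; exact: closed_closure.
Qed.

Lemma interior_lty : (mu2 C° < +oo)%E.
Proof.
pose D : set P2 := `[- K, K] `*` `[- K, K].
have mD : measurable D by apply: measurableX; exact: measurable_itv.
apply: (@le_lt_trans _ _ (mu2 D)).
  apply: le_measure; rewrite ?inE//; first exact: interior_measurable.
  move=> p /interior_subset /CK[p1 p2].
  by split; rewrite /= in_itv/= -ler_norml.
have -> : mu2 D = (mu `[(- K)%R, K] * mu `[(- K)%R, K])%E.
  by apply: product_measure1E; exact: measurable_itv.
by rewrite !lebesgue_measure_itv/= lte_fin gtrN// -!EFinB -EFinM ltry.
Qed.

Lemma lattice_box (u : seq (R * R)) : exists n : nat, forall l q x k, 0 < l <= 1 ->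
  q \in u -> unit_square x -> dilate l C (q - x + intpair k) -> k \in integer_box n.
Proof.
pose b : R := \sum_(q <- u) (`|q.1| + `|q.2|).
have qb q : q \in u -> `|q.1| <= b /\ `|q.2| <= b.
  move=> qu; rewrite /b (big_rem q)//=.
  set s := \sum_(_ <- _) _; have s0 : 0 <= s by rewrite sumr_ge0// => p _; rewrite addr_ge0.
  have := normr_ge0 q.1; have := normr_ge0 q.2.
  by move=> ? ?; split; lra.
exists (Num.truncn (K + b + 1)).+1 => l q x k /andP[l0 l1] /qb[q1 q2] [].
rewrite /= !in_itv/= => /andP[x10 x11] /andP[x20 x21] [p /CK[p1 p2] e].
have nb : K + b + 1 <= (Num.truncn (K + b + 1)).+1%:R by apply/ltW; exact: truncnS_gt.
have e1 : l * p.1 = q.1 - x.1 + k.1%:~R by rewrite -[LHS]/((l *: p).1) e.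
have e2 : l * p.2 = q.2 - x.2 + k.2%:~R by rewrite -[LHS]/((l *: p).2) e.
have aux (c d z w : R) : `|c| <= K -> `|d| <= b -> 0 <= z -> z < 1 -> l * c = d - z + w ->
    `|w| <= K + b + 1.
  move=> cK db z0 z1 /eqP; rewrite addrC -subr_eq => /eqP <-.
  have lc : `|l * c| <= K by rewrite normrM gtr0_norm// (le_trans _ cK)// ler_piMl.
  rewrite (le_trans (ler_normB _ _))// -addrA lerD// (le_trans (ler_normB _ _))// lerD//.
  by rewrite ger0_norm// ltW.
apply: mem_integer_box; apply: le_trans nb; [exact: aux e1|exact: aux e2].
Qed.

Hypothesis bnull : mu2 (boundary C) = 0%E.

(** [C] and its interior contain the same points [q - x + k] unless [x] lies in one
    of finitely many translates of the reflected, dilated boundary, a null set. *)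
Lemma torus_integral_lower (P : {fset torus R}) (A0 l tau : R) (I : finType)
    (m : I -> int * int) (th : I -> R) (mult : nat) :
  0 < l <= 1 -> (forall i, m i != (0, 0)) ->
  (forall k, #|[pred i | m i == k]| <= mult)%N ->
  ((2 * tau * (\sum_i power_spectrum (points P) (m i) * cosine_transform m th (dilate l C°) i)
    - tau ^+ 2 * ((2 * mult)%:R * \sum_i power_spectrum (points P) (m i)))%:E <=
   torus_integral (fun t => (`|card_translate P (dilate l C) t - A0| ^+ 2)%:E))%E.
Proof.
move=> l01 m0 mK; have /andP[l0 l1] := l01.
have ln0 : l != 0 by rewrite gt_eqF.
pose u := points P.
have [n box] := lattice_box u.
pose r := integer_box n.
have ur : uniq r by exact: integer_box_uniq.
have mO := interior_measurable.
have mE : measurable (dilate l C° : set P2) by exact: dilate_measurable.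
have Eoo : (mu2 (dilate l C°) < +oo)%E by apply: dilate_lty => //; exact: interior_lty.
have Er q x k : q \in u -> unit_square x -> dilate l C° (q - x + intpair k) -> k \in r.
  move=> qu Qx [p Cp e]; apply: (box l q x k) => //.
  by exists p => //; exact: interior_subset.
have mB : measurable (dilate l (boundary C) : set P2).
  by apply: dilate_measurable => //; exact: boundary_measurable.
have B0 : mu2 (dilate l (boundary C)) = 0%E.
  have H : mu2 (dilate l (boundary C)) = ((l ^+ 2)%:E * mu2 (boundary C))%E.
    by apply: dilate_measure => //; exact: boundary_measurable.
  by rewrite H bnull mule0.
pose phi q k : P2 -> P2 := affine2 (-1) (q + intpair k).
have mphi q k : measurable (phi q k @^-1` dilate l (boundary C)).
  by rewrite -[X in measurable X]setTI; apply: affine2_measurable.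
pose Z : set P2 := \big[setU/set0]_(q <- u) \big[setU/set0]_(k <- r)
  (phi q k @^-1` dilate l (boundary C)).
have mZ : measurable Z.
  apply: bigsetU_measurable => q _; exact: bigsetU_measurable.
have Z0 : mu2 Z = 0%E.
  apply: null_bigsetU => q; first exact: bigsetU_measurable.
  apply: null_bigsetU => k //.
  have N10 : -1 != 0 :> R by rewrite oppr_eq0 oner_eq0.
  have H : mu2 (phi q k @^-1` dilate l (boundary C)) =
      (((- 1) ^- 2)%:E * mu2 (dilate l (boundary C)))%E by exact: plane_measure_affine.
  by move: H; rewrite B0 mule0.
apply: (@torus_inequality R u I m th m0 _ r A0 mE Eoo ur Er mult tau _ Z) => //.
move=> x Qx Zx /=; congr EFin; rewrite real_normK ?num_real//; congr (_ ^+ 2).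
rewrite /discrepancy; congr (_ - _).
rewrite (@card_translateE _ P _ _ r)//; last first.
  by move=> q k qu; exact: box.
rewrite big_seq [RHS]big_seq; apply: eq_bigr => q qu.
rewrite big_seq [RHS]big_seq; apply: eq_bigr => k kr.
rewrite !indicE; congr (_%:R); congr nat_of_bool; apply/idP/idP; rewrite !inE; last first.
  by move=> [p Cp e]; exists p => //; exact: interior_subset.
move=> [p Cp e]; exists p => //; apply: contrapT => Op; apply: Zx.
rewrite /Z -bigcup_seq; exists q => //.
rewrite -bigcup_seq; exists k => //; exists p; first by split => //; exact: subset_closure.
by rewrite e; congr pair => /=; ring.
Qed.

End energy.

(** * Frequencies, scales and dilates *)

Section main.
Context (R : realType).
Notation mu := (@lebesgue_measure R).
Notation mu2 := (mu \x mu)%E.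
Notation P2 := (measurableTypeR R * measurableTypeR R)%type.

Definition freq_vector (k : int * int) : R * R := (2 * pi * k.1%:~R, 2 * pi * k.2%:~R).

Lemma phase_dot k (p : R * R) : phase k p = dot (freq_vector k) p.
Proof. rewrite /phase /dot /freq_vector /=; ring. Qed.

Lemma freq_vector_ge1 (k : int * int) : k != (0, 0) ->
  1 <= Num.max `|(freq_vector k).1| `|(freq_vector k).2|.
Proof.
move=> k0; have p2 : 2 <= pi :> R by exact: pi_ge2.
have H (z : int) : z != 0 -> 1 <= `|2 * pi * z%:~R : R|.
  move=> z0; rewrite normrM ger0_norm ?mulr_ge0 ?pi_ge0//.
  have : 1 <= `|z%:~R : R| by rewrite -intr_norm -[1]/(1%:~R) ler_int; lia.
  nra.
have [k1|k1] := eqVneq k.1 0; last by rewrite le_max /= H.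
have k2 : k.2 != 0.
  by apply: contra k0 => /eqP k2; rewrite (surjective_pairing k) k1 k2.
by rewrite le_max /= (H k.2)// orbT.
Qed.

Lemma freq_vector_le (k : int * int) (X : nat) : (`|k.1| <= X)%N -> (`|k.2| <= X)%N ->
  Num.max `|(freq_vector k).1| `|(freq_vector k).2| <= 8 * X%:R.
Proof.
have p4 : pi <= 4 :> R by have := pihalf_lt2 R; lra.
have H (z : int) : (`|z| <= X)%N -> `|2 * pi * z%:~R : R| <= 8 * X%:R.
  move=> zX; rewrite normrM ger0_norm ?mulr_ge0 ?pi_ge0//.
  rewrite ler_pM ?mulr_ge0 ?pi_ge0//; first lra.
  by rewrite -intr_norm (_ : X%:R = X%:Z%:~R)// ler_int; lia.
by move=> k1 k2; rewrite ge_max !H.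
Qed.

Lemma choose_scale (N : nat) : (1 <= N)%N -> exists X : nat, [/\ (0 < X)%N,
  2 * N%:R <= X%:R ^+ 2 :> R & X%:R <= 3 * Num.sqrt N%:R :> R].
Proof.
move=> N1; set s := Num.sqrt N%:R.
have s1 : 1 <= s by have := @ler_wsqrtr R 1 N%:R; rewrite sqrtr1; apply; rewrite ler1n.
have ss : s ^+ 2 = N%:R by rewrite sqr_sqrtr.
exists (Num.truncn (2 * s)).+1.
have /andP[t1 t2] := @truncn_itv _ (2 * s) ltac:(lra).
split => //.
  rewrite -ss; apply: (@le_trans _ _ ((2 * s) ^+ 2)); first nra.
  by rewrite lerXn2r ?nnegrE// ?ltW//; lra.
by rewrite -natr1; lra.
Qed.

Lemma radial_transform_strip (C : set (R * R)) (K a : R) (k : int * int) :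
  0 < K -> (forall p, C p -> `|p.1| <= K /\ `|p.2| <= K) ->
  (forall p, C p -> a <= dot (freq_vector k) p) ->
  21 ^- 3 * fine (mu2 (strip C (freq_vector k) a)) <=
  Rintegral mu `[0, 1] (radial_transform C° (fun p => phase k p - a + 20)).
Proof.
move=> K0 CK amin; pose v p := phase k p - a + 20.
have mv : measurable_fun setT (v : P2 -> R).
  apply: (@measurable_funD _ P2) => //; apply: (@measurable_funB _ P2) => //.
  exact: phase_measurable.
have v20 p : C° p -> 20 <= v p.
  move=> /interior_subset/amin; rewrite /v phase_dot => ap; lra.
have := radial_transform_ge (interior_measurable C) (interior_lty K0 CK) mv v20.
suff -> : C° `&` [set y | v y <= 21] = strip C (freq_vector k) a by [].
rewrite /strip; congr (_ `&` _).
by apply/seteqP; split => p /=; rewrite /v phase_dot => h; lra.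
Qed.

Lemma strip_lty (C : set (R * R)) (K a : R) (xi : R * R) :
  0 < K -> (forall p, C p -> `|p.1| <= K /\ `|p.2| <= K) ->
  (mu2 (strip C xi a) < +oo)%E.
Proof.
move=> K0 CK; apply: le_lt_trans (interior_lty K0 CK).
apply: le_measure; rewrite ?inE; [exact: strip_measurable|exact: interior_measurable|].
exact: subIsetl.
Qed.

(** The phase [l * (a - 20) - pi / 2] is the one that makes the transform of
    the dilate by [l] an integral of [- sin (l * (phase - a + 20))]. *)
Lemma radial_transform_dilate (C : set (R * R)) (K a l : R) (I : finType)
    (m : I -> int * int) (i : I) (th : I -> R) :
  0 < K -> (forall p, C p -> `|p.1| <= K /\ `|p.2| <= K) -> 0 < l ->
  th i = l * (a - 20) - pi / 2 ->
  radial_transform C° (fun p => phase (m i) p - a + 20) l =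
  (1 - l) ^+ 3 * cosine_transform m th (dilate l C°) i.
Proof.
move=> K0 CK lpos thE; rewrite /cosine_transform Rintegral_dilate//; last 4 first.
- by rewrite gt_eqF.
- exact: interior_measurable.
- exact: interior_lty CK.
- apply: (@bmeas_cos _ P2); apply: (@measurable_funB _ P2) => //.
  exact: phase_measurable.
rewrite /radial_transform /radial_weight (mulrC (l ^+ 2)) -mulrA; congr (_ * (_ * _)).
apply: eq_Rintegral => p _; rewrite -cosDpihalf -cosN thE; congr cos.
by rewrite /phase /affine2 /=; ring.
Qed.

End main.
Arguments freq_vector {R}.

Theorem theorem4 (R : realType) (C : set (R * R)) :
  convex_body C -> C2_boundary C ->
  exists2 c : R, 0 < c &
    forall (N : nat) (P : {fset torus R}), (1 <= N)%N -> #|` P| = N ->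
      ((c * Num.sqrt N%:R)%:E <=
       \int[lebesgue_measure]_(lambda in `[0%R, 1%R])
         torus_integral (fun t =>
           (`|card_translate P (dilate lambda C) t
              - lambda ^+ 2 * N%:R * area C| ^+ 2)%:E))%E.
Proof.
move=> [bC convC iC] [L [x [y [L0 per [Cx Cy] speed bij]]]].
have [K K0 CK] := bounded_box bC.
have bnull : (lebesgue_measure \x lebesgue_measure)%E (boundary C) = 0%E.
  apply: (curve_null L0 Cx Cy speed); first exact: boundary_measurable.
  exact: curve_onto bij.
have [c0 c00 Hstrip] := strip_area L0 per Cx Cy speed bij convC K0 CK iC.
(* The constants are kept as variables so that [ring] and [field] do not expand
   their powers. *)
have [e eE e0] : exists2 e : R, e = 8 & 0 < e by exists 8.
have [b bE b0] : exists2 b : R, b = 21 ^- 3 & 0 < b.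
  by exists (21 ^- 3) => //; rewrite invr_gt0 exprn_gt0.
pose d := b ^+ 2 * c0 ^+ 2 / (4 * e ^+ 3) / 3.
exists d; first by rewrite !divr_gt0 ?mulr_gt0 ?exprn_gt0.
move=> N P N1 cP.
have [X [X0 XN XsN]] := @choose_scale R N N1.
pose I := freqs X; pose m : I -> int * int := @freq X.
pose u := points P.
have su : size u = N by rewrite size_map -cP.
have xir (i : I) : 1 <= Num.max `|(freq_vector (m i) : R * R).1| `|(freq_vector (m i) : R * R).2|.
  by apply: freq_vector_ge1; exact: freq_neq0.
have /choice[a Ha] : forall i : I, exists a, _ := fun i => Hstrip _ (xir i).
pose th l i : R := l * (a i - 20) - pi / 2.
pose v i (p : R * R) := phase (m i) p - a i + 20.
pose A i := radial_transform C° (v i).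
pose pw i := power_spectrum u (m i).
pose S := \sum_i pw i.
have mO := interior_measurable C.
have Ooo := interior_lty K0 CK.
have mv i : measurable_fun setT (v i : measurableTypeR R * measurableTypeR R -> R).
  by apply: measurable_funD => //; apply: measurable_funB => //; exact: phase_measurable.
pose s := Num.sqrt (N%:R : R).
(* A lower bound for the mean transform, common to all frequencies: their
   coordinates are at most [X], and 2 pi is at most 8. *)
pose w := b * (c0 / (e * X%:R * Num.sqrt (e * X%:R))).
have Aw i : w <= Rintegral lebesgue_measure `[0, 1] (A i).
  have [amin astrip] := Ha i.
  apply: le_trans (radial_transform_strip K0 CK amin).
  rewrite /w -bE ler_pM2l//.
  have Too := strip_lty (a i) (freq_vector (m i)) K0 CK.
  have : (fine ((lebesgue_measure \x lebesgue_measure)%E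
      (strip C (freq_vector (m i)) (a i))))%:E =
      (lebesgue_measure \x lebesgue_measure)%E (strip C (freq_vector (m i)) (a i)).
    by apply: fineK; rewrite ge0_fin_numE.
  rewrite -lee_fin => ->; apply: le_trans astrip.
  have := xir i; set r := Num.max _ _ => r1.
  have rX : r <= e * X%:R.
    rewrite eE; have [f1 f2] := freq_le i; exact: freq_vector_le.
  have r0 : 0 < r by apply: lt_le_trans r1.
  have q0 : 0 < Num.sqrt r by rewrite sqrtr_gt0.
  rewrite lee_fin ler_pM2l// lef_pV2 ?posrE ?mulr_gt0 ?sqrtr_gt0 ?mulr_gt0 ?ltr0n//.
  by rewrite ler_pM// ?ler_wsqrtr// ltW.
(* The maximiser of [2 * tau * w - 2 * tau ^+ 2 * X ^ 2]. *)
pose tau := w / (2 * X%:R ^+ 2).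
pose G l := 2 * tau * (\sum_i pw i * A i l) - tau ^+ 2 * ((2 * X ^ 2)%:R * S).
have iA i := integrable_radial_transform mO Ooo (mv i).
have mI : measurable (`[0%R, 1%R]%classic : set (measurableTypeR R)) by exact: measurable_itv.
have mu01 : lebesgue_measure (`[0%R, 1%R]%classic : set R) = 1%E.
  by rewrite lebesgue_measure_itv/= lte_fin ltr01 -EFinB subr0.
have Ioo : (lebesgue_measure (`[0%R, 1%R]%classic : set R) < +oo)%E by rewrite mu01 ltry.
have ipA i : lebesgue_measure.-integrable `[0%R, 1%R] (EFin \o (fun l => pw i * A i l)).
  exact: (integrableZl mI _ (iA i)).
have isA : lebesgue_measure.-integrable `[0%R, 1%R] (EFin \o (fun l => \sum_i pw i * A i l)).
  have := @integrable_sum _ (measurableTypeR R) _ lebesgue_measure _ mI _ (index_enum I) predT (fun i => EFin \o (fun l => pw i * A i l)) (fun i _ => ipA i).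
  by apply: eq_integrable => // l _; rewrite /= sumEFin.
have iG1 : lebesgue_measure.-integrable `[0%R, 1%R]
    (EFin \o (fun l => 2 * tau * (\sum_i pw i * A i l))).
  exact: (integrableZl mI _ isA).
have iG2 : lebesgue_measure.-integrable `[0%R, 1%R]
    (EFin \o (cst (tau ^+ 2 * ((2 * X ^ 2)%:R * S)) : R -> R)).
  by apply: (@bmeas_integrable _ (measurableTypeR R)) => //; exact: bmeas_cst.
have iG : lebesgue_measure.-integrable `[0%R, 1%R] (EFin \o G).
  have := integrableB mI iG1 iG2.
  by apply: eq_integrable.
have X0' : 0 < X%:R :> R by rewrite ltr0n.
have pw0 i : 0 <= pw i by exact: power_ge0.
have w0 : 0 < w by rewrite /w !(mulr_gt0, divr_gt0, invr_gt0, exprn_gt0, sqrtr_gt0).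
have tau0 : 0 < tau by rewrite /tau divr_gt0// mulr_gt0// exprn_gt0.
have S0 : 0 <= S by rewrite sumr_ge0.
apply: (@le_trans _ _ (Rintegral lebesgue_measure `[0%R, 1%R] G)%:E).
  rewrite lee_fin /G (RintegralB mI iG1 iG2) (RintegralZl _ mI isA)
    (Rintegral_sum _ _ mI ipA).
  rewrite (Rintegral_cst _ mI) (_ : fine _ = 1) ?mulr1; last first.
    exact: (congr1 fine mu01).
  apply: (@le_trans _ _ (2 * tau * (w * S) - tau ^+ 2 * ((2 * X ^ 2)%:R * S))); last first.
    have t20 : 0 < 2 * tau by exact: mulr_gt0.
    rewrite lerD2r (ler_pM2l t20) /S mulr_sumr ler_sum// => i _.
    rewrite (RintegralZl _ mI (iA i)) mulrC ler_wpM2l//; exact: Aw.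
  have SX : N%:R * X%:R ^+ 4 / 2 <= S.
    have := @sum_power_freqs R u X; rewrite su -/S; apply: le_trans.
    rewrite natrM !natrX.
    have : N%:R * (2 * N%:R) * X%:R ^+ 2 <= N%:R * X%:R ^+ 2 * X%:R ^+ 2 :> R.
      by rewrite ler_wpM2r ?sqr_ge0// ler_wpM2l.
    lra.
  have -> : 2 * tau * (w * S) - tau ^+ 2 * ((2 * X ^ 2)%:R * S) = w ^+ 2 / (2 * X%:R ^+ 2) * S.
    by rewrite /tau natrM natrX; field; rewrite gt_eqF.
  apply: (@le_trans _ _ (w ^+ 2 / (2 * X%:R ^+ 2) * (N%:R * X%:R ^+ 4 / 2))); last first.
    have wX : 0 < w ^+ 2 / (2 * X%:R ^+ 2).
      by apply: divr_gt0; [exact: exprn_gt0|apply: mulr_gt0 => //; exact: exprn_gt0].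
    by rewrite (ler_pM2l wX).
  have w2 : w ^+ 2 = b ^+ 2 * c0 ^+ 2 / (e ^+ 3 * X%:R ^+ 3).
    have q2 : Num.sqrt (e * X%:R) ^+ 2 = e * X%:R :> R by rewrite sqr_sqrtr// mulr_ge0// ltW.
    rewrite /w !exprMn exprVn exprMn q2.
    by field; rewrite !gt_eqF.
  have ss : N%:R = s * s by rewrite -expr2 sqr_sqrtr.
  have s0 : 0 < s by rewrite sqrtr_gt0 ltr0n.
  rewrite w2.
  have -> : b ^+ 2 * c0 ^+ 2 / (e ^+ 3 * X%:R ^+ 3) / (2 * X%:R ^+ 2) * (N%:R * X%:R ^+ 4 / 2)
      = b ^+ 2 * c0 ^+ 2 / (4 * e ^+ 3) * (N%:R / X%:R) by field; rewrite !gt_eqF.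
  have -> : d * Num.sqrt N%:R = b ^+ 2 * c0 ^+ 2 / (4 * e ^+ 3) * (s / 3).
    by rewrite /d -/s; field; rewrite gt_eqF.
  rewrite ler_pM2l ?divr_gt0 ?mulr_gt0 ?exprn_gt0//.
  by rewrite ler_pdivlMr// ss -mulrA ler_pM2l// mulrC ler_pdivrMr// mulrC.
(* [l = 0] is left out: the dilation by 0 has no inverse. *)
apply: (@integrable_le_lower_integral _ (measurableTypeR R) _ _ _ [set 0%R]) => //.
- exact: lebesgue_measure_set1.
- by move=> l lI; apply: integral_ge0 => p _; rewrite lee_fin exprn_ge0.
move=> l /=; rewrite in_itv/= => /andP[l0 l1] ln0.
have lpos : 0 < l by rewrite lt_def l0 andbT; apply/eqP.
have l01 : 0 < l <= 1 by rewrite lpos.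
(* The weight of the average enters through the choice of [tau] at each [l]. *)
apply: le_trans (torus_integral_lower K0 CK bnull P _ (tau * (1 - l) ^+ 3) (th l) l01
  (@freq_neq0 X) (@freq_mult X)).
have AE i : A i l = (1 - l) ^+ 3 * cosine_transform m (th l) (dilate l C°) i.
  exact: radial_transform_dilate CK lpos _.
rewrite lee_fin /G; apply: lerB.
  have -> : \sum_i pw i * A i l =
      (1 - l) ^+ 3 * \sum_i pw i * cosine_transform m (th l) (dilate l C°) i.
    by rewrite mulr_sumr; apply: eq_bigr => i _; rewrite AE mulrCA.
  by rewrite le_eqVlt; apply/orP; left; apply/eqP; rewrite /pw /m /u; ring.
rewrite -/u ler_wpM2r// ?mulr_ge0//.
by rewrite exprMn ler_piMr ?sqr_ge0// -exprM exprn_ile1 ?subr_ge0// gerBl.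
Qed.
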